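(* Let $\lambda$ be a Young diagram, let $m_1,m_2\in\mathbb N$ be the smallest natural numbers with $\lambda\subseteq[m_1]\times[m_2]$, let $\underline d=(d_\ell)_{\ell\in\{1-m_2,\dots,m_1-1\}}\in\mathbb N^{m_1+m_2-1}$ and let $k\in\mathbb N$. Then the restricted order polytope $\mathcal O(\lambda)^k_{\underline d}$ and the restricted chain polytope $\mathcal C(\lambda)^k_{\underline d}$ are mutation equivalent.
   Context: $\mathbb N=\{1,2,\dots\}$, $[n]=\{1,\dots,n\}$, and $\mathbb N^2$ carries the componentwise partial order $(a,b)\le(c,d)$ iff $a\le c$ and $b\le d$. A Young diagram is a finite nonempty down-set $\lambda\subseteq\mathbb N^2$, regarded as a subposet of $\mathbb N^2$. $\mathbb R^\lambda$ is the real vector space with basis $\{e_p\mid p\in\lambda\}$, with lattice $\mathbb Z^\lambda$. For $\ell\in\{1-m_2,\dots,m_1-1\}$ the $\ell$th diagonal of $\lambda$ is $\{(i,j)\in\lambda\mid i-j=\ell\}$ and $r_\ell$ denotes its maximal element. Order polytope: $\mathcal O(\lambda)=\{x\in\mathbb R^\lambda\mid 0\le x_p\le x_q\le 1 \text{ for all } p\le q \text{ in }\lambda\}$. Chain polytope: $\mathcal C(\lambda)=\{x\in\mathbb R^\lambda\mid 0\le x_{p_1}+\dots+x_{p_s}\le 1 \text{ for all chains } p_1<\dots<p_s \text{ in }\lambda\}$. Restricted order polytope: $\mathcal O(\lambda)^k_{\underline d}=\{x\in k\mathcal O(\lambda)\mid \sum_{i-j=\ell}x_{(i,j)}=d_\ell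 \text{ for all } \ell\in\{1-m_2,\dots,m_1-1\}\}$. Restricted chain polytope: $\mathcal C(\lambda)^k_{\underline d}=\{x\in k\mathcal C(\lambda)\mid \sum_{p\le r_\ell}x_p=d_\ell \text{ for all } \ell\in\{1-m_2,\dots,m_1-1\}\}$. Tropical map: for a primitive $w\in\mathbb Z^N$ and a lattice polytope $F\subset w^\perp=\{x\mid x\cdot w=0\}$, $\varphi_{w,F}:\mathbb R^N\to\mathbb R^N$, $x\mapsto x-\big(\min_{f\in F}x\cdot f\big)w$. If $P\subset\mathbb R^N$ is a polytope and $\varphi_{w,F}(P)$ is convex, then $\varphi_{w,F}(P)$ is called a combinatorial mutation of $P$. Two polytopes $P,Q$ are mutation equivalent if there is a sequence $P=P_0,P_1,\dots,P_s=Q$ such that each $P_{t}=\varphi_{w_t,F_t}(P_{t-1})$ is a combinatorial mutation of $P_{t-1}$. *)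

(* Defs.v *)
From HB Require Import structures.
From mathcomp Require Import all_boot all_order all_algebra finmap.
From mathcomp Require Import boolp classical_sets reals convex.

Set Implicit Arguments.
Unset Strict Implicit.
Unset Printing Implicit Defensive.

Import Order.TTheory GRing.Theory Num.Theory.

Local Open Scope classical_set_scope.
Local Open Scope ring_scope.

Section Mutation.
Variables (R : realType) (T : finType).

(* R^N, with coordinates indexed by a finite type T with N elements *)
Local Notation vec := {ffun T -> R^o}.

Implicit Types (P Q F : set vec) (w : {ffun T -> int}).

Definition dot (x y : vec) : R := \sum_p x p * y p.

Definition int_vec w : vec := [ffun p => (w p)%:~R].

(* The convex hull is empty for n = 0, so the empty set is a polytope; this
   matters because a restricted polytope is empty when k is too small. *)
Definition conv_hull (n : nat) (v : 'I_n -> vec) : set vec :=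
  [set \sum_i a i *: v i | a in
    [set a : 'I_n -> R | (forall i, 0 <= a i) /\ \sum_i a i = 1]].

Definition polytope P : Prop :=
  exists (n : nat) (v : 'I_n -> vec), P = conv_hull v.

Definition lattice_polytope P : Prop :=
  exists (n : nat) (v : 'I_n -> {ffun T -> int}),
    P = conv_hull (fun i => int_vec (v i)).

(* The gcd over no nonzero entries is 0, so a primitive vector is nonzero. *)
Definition primitive_vec w : Prop := \big[gcdn/0]_p `|w p|%N = 1%N.

(* For a nonempty polytope F, the infimum is attained. *)
Definition tropical_map w F (x : vec) : vec :=
  x - inf [set dot x f | f in F] *: int_vec w.

Definition combinatorial_mutation P Q : Prop :=
  polytope P /\
  exists w F,
    [/\ primitive_vec w,
        lattice_polytope F /\ F !=set0,
        F `<=` [set x | dot x (int_vec w) = 0],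
        Q = tropical_map w F @` P
      & convex_set Q].

Definition mutation_equivalent P Q : Prop :=
  [/\ polytope P, polytope Q &
      exists (s : nat) (P_ : nat -> set vec),
        [/\ P_ 0 = P, P_ s = Q &
            forall t, (t < s)%N -> combinatorial_mutation (P_ t) (P_ t.+1)]].

End Mutation.

(* The order of nat *p nat is componentwise. It also has points with a zero
   coordinate; young_diagram excludes them. *)
Notation grid := (nat *p nat)%type.

Definition young_diagram (lam : {fset grid}) : Prop :=
  [/\ lam != fset0,
      forall p : grid, p \in lam -> (0 < p.1)%N /\ (0 < p.2)%N
    & forall p q : grid, p \in lam -> (0 < q.1)%N -> (0 < q.2)%N ->
        (q <= p)%O -> q \in lam].

Definition in_box (lam : {fset grid}) (m1 m2 : nat) : Prop :=
  forall p : grid, p \in lam -> (0 < p.1 <= m1)%N /\ (0 < p.2 <= m2)%N.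

Definition smallest_box (lam : {fset grid}) (m1 m2 : nat) : Prop :=
  [/\ (0 < m1)%N, (0 < m2)%N, in_box lam m1 m2
    & forall n1 n2, in_box lam n1 n2 -> (m1 <= n1)%N /\ (m2 <= n2)%N].

Definition diag (p : grid) : int := p.1%:Z - p.2%:Z.

Section Polytopes.
Variables (R : realType) (lam : {fset grid}).
Local Notation vec := {ffun lam -> R^o}.

Definition order_polytope : set vec :=
  [set x | forall p q : lam, (val p <= val q)%O ->
     [/\ 0 <= x p, x p <= x q & x q <= 1]].

Definition chain_polytope : set vec :=
  [set x | forall s : seq lam, sorted (fun p q => (val p < val q)%O) s ->
     0 <= \sum_(p <- s) x p <= 1].

Definition dilate (k : nat) (P : set vec) : set vec :=
  [set k%:R *: x | x in P].

Definition max_on_diag (l : int) (r : lam) : Prop :=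
  diag (val r) = l /\
  forall p : lam, diag (val p) = l -> (val r <= val p)%O -> p = r.

Definition restricted_order_polytope (m1 m2 k : nat) (d : int -> nat) :
    set vec :=
  [set x | dilate k order_polytope x /\
     forall l : int, 1 - m2%:Z <= l <= m1%:Z - 1 ->
       \sum_(p : lam | diag (val p) == l) x p = (d l)%:R].

(* For l in this range, the diagonal is a nonempty chain, so the maximal
   element r exists and is unique. *)
Definition restricted_chain_polytope (m1 m2 k : nat) (d : int -> nat) :
    set vec :=
  [set x | dilate k chain_polytope x /\
     forall l : int, 1 - m2%:Z <= l <= m1%:Z - 1 ->
       forall r : lam, max_on_diag l r ->
         \sum_(p : lam | (val p <= val r)%O) x p = (d l)%:R].

End Polytopes.

Arguments restricted_order_polytope : clear implicits.
Arguments restricted_chain_polytope : clear implicits.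

(* Main.v *)
Require Import Defs.
From mathcomp Require Import all_boot all_order all_algebra finmap.
From mathcomp Require Import boolp classical_sets reals convex interval_inference.
From mathcomp Require Import ring lra zify.

(** The piecewise-linear Robinson-Schensted-Knuth correspondence maps an
order-preserving filling of [lam] to an array [A] on [lam] so that the sum over
the diagonal ending at [r] becomes the sum of [A] over the rectangle below [r]
(Gansner), and the largest entry becomes the largest weight of a chain (Greene).
It therefore maps the restricted order polytope onto the restricted chain
polytope. It is a composition of local moves, one for each removed corner: if
the corner is [q_0 = (i, j)] and [q_r = (i - r, j - r)], then [x] at [q_0] loses
the maximum [a_0] of its lower neighbours, and [x] at [q_r], [r > 0], is replaced
by [a_r + b_(r-1) - x], where [a_r] and [b_r] are the maximum and the minimum of
the lower neighbours of [q_r]. As [a_r + b_r] is linear, the nonlinear part of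
the move is the composition of the tropical maps with [w = e_(q_(r+1)) - e_(q_r)]
and [F] the segment between the unit vectors of the two lower neighbours of
[q_r]; all the intermediate sets are convex. The rest is linear and is realized
by tropical maps for a point [F], up to the signs of the coordinates [q_r],
[r > 0]. The signs are adjusted at the start: two coordinates are constant and
positive on the restricted order polytope, which leaves room to realize a change
of sign by shears. *)

Set Implicit Arguments.
Unset Strict Implicit.
Unset Printing Implicit Defensive.

Import Order.TTheory GRing.Theory Num.Theory.

Local Open Scope classical_set_scope.
Local Open Scope ring_scope.

(** * Polytopes *)

Lemma sum_pairE (V : nmodType) (I J : finType) (F : I * J -> V) :
  \sum_k F k = \sum_i \sum_j F (i, j).
Proof. by rewrite pair_bigA; apply: eq_bigr => -[]. Qed.

Section Polytopes.
Variables (R : realType) (T : finType).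
Local Notation vec := {ffun T -> R^o}.
Implicit Types (P Q : set vec) (x y v : vec).

(** Two explicit weights replace the unit-interval weight of [convex_set], so that convexity can be
    split into scaling and adding. *)
Definition cvx P := forall x y (a b : R),
  P x -> P y -> 0 <= a -> 0 <= b -> a + b = 1 -> P (a *: x + b *: y).

Lemma cvxP P : convex_set P <-> cvx P.
Proof.
split=> [cP x y a b Px Py a0 b0 ab | cP x y l].
  have a1 : a <= 1 by rewrite -ab lerDl.
  have h := cP x y (Itv01 a0 a1) (mem_set Px) (mem_set Py).
  have -> : b = 1 - a by rewrite -ab addrC addKr.
  exact: set_mem h.
rewrite !inE => Px Py; apply: cP => //.
  by rewrite subr_ge0.
by rewrite [LHS]addrC subrK.
Qed.

Lemma cvx_sum P (I : finType) (a : I -> R) (v : I -> vec) : cvx P ->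
  (forall i, 0 <= a i) -> \sum_i a i = 1 -> (forall i, P (v i)) ->
  P (\sum_i a i *: v i).
Proof.
move=> cP a0 a1 Pv.
(* Partial combinations are renormalized to total weight 1, which makes an induction on the list
   possible; a tail of total weight 0 contributes nothing. *)
have H (s : seq I) : 0 < \sum_(i <- s) a i ->
    P ((\sum_(i <- s) a i)^-1 *: \sum_(i <- s) a i *: v i).
  elim: s => [|i s IH]; first by rewrite big_nil ltxx.
  rewrite !big_cons => h.
  have s0 : 0 <= \sum_(j <- s) a j by apply: sumr_ge0.
  have [s1|] := boolP (\sum_(j <- s) a j == 0).
    have z : \sum_(j <- s) a j *: v j = 0.
      apply: big1_seq => j /andP[_ js]; move: s1.
      rewrite psumr_eq0// => /allP /(_ _ js) /= /eqP ->; exact: scale0r.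
    move: h; rewrite (eqP s1) z !addr0 => h.
    by rewrite scalerA mulVf ?gt_eqF// scale1r.
  move=> sn; have sp : 0 < \sum_(j <- s) a j by rewrite lt_def sn.
  set S := \sum_(j <- s) a j in h s0 sn sp IH *.
  have -> : (a i + S)^-1 *: (a i *: v i + \sum_(j <- s) a j *: v j) =
    ((a i + S)^-1 * a i) *: v i +
      ((a i + S)^-1 * S) *: (S^-1 *: \sum_(j <- s) a j *: v j).
    by rewrite !scalerDr !scalerA -mulrA mulfV// mulr1.
  apply: cP => //; first exact: IH.
  - by rewrite mulr_ge0// invr_ge0 ltW.
  - by rewrite mulr_ge0// invr_ge0 ltW.
  - by rewrite -mulrDr mulVf// gt_eqF.
by have := H (index_enum I); rewrite a1 invr1 scale1r; apply; exact: ltr01.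
Qed.

Lemma cvx_conv_hull n (v : 'I_n -> vec) : cvx (conv_hull v).
Proof.
move=> _ _ a b [f [f0 f1] <-] [g [g0 g1] <-] a0 b0 ab.
exists (fun i => a * f i + b * g i); first split.
- by move=> i; rewrite addr_ge0// mulr_ge0.
- by rewrite big_split -!mulr_sumr f1 g1 !mulr1.
rewrite !scaler_sumr -big_split /=; apply: eq_bigr => i _.
by rewrite !scalerA -scalerDl.
Qed.

Lemma conv_hull_in n (v : 'I_n -> vec) i : conv_hull v (v i).
Proof.
exists (fun j => (j == i)%:R); first split.
- by move=> j; rewrite ler0n.
- by rewrite (bigD1 i)//= eqxx big1 ?addr0// => j /negPf ->.
by rewrite (bigD1 i)//= eqxx scale1r big1 ?addr0// => j /negPf ->; rewrite scale0r.
Qed.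

Lemma polytope_cvx P : polytope P -> cvx P.
Proof. by move=> [n [v ->]]; exact: cvx_conv_hull. Qed.

(** Sum and product types will index the vertices below, so the ordinals of [polytope] are replaced
    by any finite type. *)
Lemma polytope_fin P (I : finType) (v : I -> vec) : cvx P ->
  (forall i, P (v i)) ->
  (forall x, P x -> exists a : I -> R,
     [/\ forall i, 0 <= a i, \sum_i a i = 1 & x = \sum_i a i *: v i]) ->
  polytope P.
Proof.
move=> cP Pv H; exists #|I|, (v \o enum_val); apply/seteqP; split=> x.
  move=> /H [a [a0 a1 ->]]; exists (a \o enum_val); first split=> //=.
    by rewrite -a1 [RHS](reindex _ (onW_bij _ (@enum_val_bij I))).
  by rewrite [RHS](reindex _ (onW_bij _ (@enum_val_bij I))).
move=> [a [a0 a1] <-]; apply: cvx_sum => // i; exact: Pv.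
Qed.

Lemma dotDl x y v : dot (x + y) v = dot x v + dot y v.
Proof.
by rewrite /dot -big_split; apply: eq_bigr => i _; rewrite ffunE mulrDl.
Qed.

Lemma dotZl a x v : dot (a *: x) v = a * dot x v.
Proof.
by rewrite /dot mulr_sumr; apply: eq_bigr => i _; rewrite ffunE mulrA.
Qed.

Lemma dotC x v : dot x v = dot v x.
Proof. by apply: eq_bigr => i _; rewrite mulrC. Qed.

Lemma dotDr x y v : dot v (x + y) = dot v x + dot v y.
Proof. by rewrite !(dotC v) dotDl. Qed.

Lemma dotZr a x v : dot v (a *: x) = a * dot v x.
Proof. by rewrite !(dotC v) dotZl. Qed.

Lemma dot_suml (I : finType) (a : I -> R) (u : I -> vec) v :
  dot (\sum_i a i *: u i) v = \sum_i a i * dot (u i) v.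
Proof.
elim/big_rec2: _ => [|i s y _ <-]; last by rewrite dotDl dotZl.
by rewrite /dot big1// => i _; rewrite ffunE mul0r.
Qed.

(* New vertices appear where an edge from the kept side to the discarded side
   crosses the hyperplane. A kept vertex [v i0] fills the unused indices. *)
Lemma polytope_cut P (h : vec) (c : R) :
  polytope P -> polytope [set x | P x /\ dot x h <= c].
Proof.
move=> pP; have cP := polytope_cvx pP.
have cQ : cvx [set x | P x /\ dot x h <= c].
  move=> x y a b [Px hx] [Py hy] a0 b0 ab; split; first exact: cP.
  rewrite dotDl !dotZl -[leRHS]mul1r -ab mulrDl.
  by apply: lerD; apply: ler_wpM2l.
case: pP => n [v eP].
pose s i := dot (v i) h - c.
have hs (a : 'I_n -> R) : \sum_i a i = 1 ->
    dot (\sum_i a i *: v i) h - c = \sum_i a i * s i.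
  move=> a1; rewrite dot_suml -[X in _ - X]mul1r -a1 mulr_suml -sumrB.
  by apply: eq_bigr => i _; rewrite -mulrBr.
have Pv i : P (v i) by rewrite eP; exact: conv_hull_in.
(* If every vertex is discarded, the cut is empty and is the hull of the empty family. *)
case: (pselect (exists i0, s i0 <= 0)) => [[i0 si0]|noi]; last first.
  apply: (@polytope_fin _ void (of_void _)) => // x [Px hx].
  move: Px; rewrite eP => -[a [a0 a1] ax].
  have : \sum_i a i * s i <= 0 by rewrite -hs// ax subr_le0.
  have sp i : 0 < s i.
    by rewrite ltNge; apply/negP => si; apply: noi; exists i.
  have : \sum_i a i * s i == 0 -> False.
    rewrite psumr_eq0 => [|i _]; last by rewrite mulr_ge0// ltW.
    move=> /allP e0; move: a1; rewrite big1 => [/esym/eqP|i _].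
      by rewrite oner_eq0.
    have /(_ (mem_index_enum _)) := e0 i.
    by rewrite /= mulf_eq0 (gt_eqF (sp i)) orbF => /eqP.
  move=> e1 e2; exfalso; apply: e1; rewrite eq_le e2 /=.
  by apply: sumr_ge0 => i _; rewrite mulr_ge0// ltW.
pose z i j := (s j / (s j - s i)) *: v i + (- s i / (s j - s i)) *: v j.
pose w (k : 'I_n + 'I_n * 'I_n) := match k with
  | inl i => if s i <= 0 then v i else v i0
  | inr (i, j) => if (s i <= 0) && (0 < s j) then z i j else v i0 end.
have Qv i : s i <= 0 -> [set x | P x /\ dot x h <= c] (v i).
  by move=> si; split => //; rewrite -subr_le0.
apply: (@polytope_fin _ _ w) => //.
  case=> [i|[i j]] /=; first by case: ifP => *; apply: Qv.
  case: ifP => [/andP[si sj]|_]; last exact: Qv.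
  have dp : 0 < s j - s i by lra.
  have e1 : s j / (s j - s i) + - s i / (s j - s i) = 1.
    by rewrite -mulrDl mulfV// gt_eqF.
  split; first apply: cP => //.
  - by rewrite divr_ge0// ltW.
  - by rewrite divr_ge0 ?oppr_ge0// ltW.
  have hi : dot (v i) h = s i + c by rewrite subrK.
  have hj : dot (v j) h = s j + c by rewrite subrK.
  suff -> : dot (z i j) h = c by [].
  by rewrite dotDl !dotZl hi hj; field; rewrite gt_eqF.
move=> x [Px hx]; move: Px; rewrite eP => -[a [a0 a1] ax].
have sle : \sum_i a i * s i <= 0 by rewrite -hs// ax subr_le0.
pose A := \sum_(i | 0 < s i) a i * s i.
pose B := - \sum_(i | ~~ (0 < s i)) a i * s i.
have AB : A <= B by move: sle; rewrite (bigID (fun i => 0 < s i)) /= /A /B; lra.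
have A0 : 0 <= A by apply: sumr_ge0 => i si; rewrite mulr_ge0// ltW.
have [B0|Bn0] := eqVneq B 0.
  have A00 : A = 0 by apply/eqP; rewrite eq_le A0 andbT -B0.
  have az i : 0 < s i -> a i = 0.
    move=> si; move/eqP: A00; rewrite psumr_eq0 => [|k sk]; last first.
      by rewrite mulr_ge0// ltW.
    move/allP/(_ i (mem_index_enum _)); rewrite si /= mulf_eq0 (gt_eqF si) orbF.
    by move/eqP.
  exists (fun k => if k is inl i then a i else 0); split.
  - by case.
  - by rewrite big_sumType /= a1 big1 ?addr0.
  rewrite big_sumType /= [X in _ + X]big1 ?addr0 => [|i _]; last exact: scale0r.
  rewrite -ax; apply: eq_bigr => i _; case: ifPn => //.
  by rewrite -ltNge => /az ->; rewrite !scale0r.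
have Bp : 0 < B by rewrite lt_def Bn0 (le_trans A0).
(* Each discarded vertex [v j] is shared among the kept [v i] in proportion to [- a i * s i], whose
   total is [B]. The crossing points [z i j] with weights [om i j] absorb all of the weight of [v j]
   and the fraction [A / B] of that of [v i]; [be i] is the rest. *)
pose om i j := if (s i <= 0) && (0 < s j) then a i * a j * (s j - s i) / B else 0.
pose be i := if s i <= 0 then a i * (1 - A / B) else 0.
have eom i : s i <= 0 -> \sum_j om i j *: w (inr (i, j)) =
    (a i * (A / B)) *: v i - (a i * s i / B) *: (\sum_(j | 0 < s j) a j *: v j).
  move=> si; rewrite /om si /=.
  transitivity (\sum_(j | 0 < s j) ((a i * (a j * s j) / B) *: v i
     - (a i * s i / B) *: (a j *: v j))).
    rewrite [RHS]big_mkcond /=; apply: eq_bigr => j _; rewrite si /=.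
    case: ifP => sj; last by rewrite scale0r.
    have dp : s j - s i != 0 by rewrite gt_eqF//; lra.
    rewrite /z scalerDr !scalerA -scaleNr; congr (_ *: _ + _ *: _); field.
      by rewrite Bn0.
    by rewrite Bn0.
  rewrite sumrB -scaler_sumr; congr (_ - _).
  by rewrite -scaler_suml -mulr_suml -mulr_sumr mulrA.
have key : \sum_(k : 'I_n + 'I_n * 'I_n)
    (match k with inl i => be i | inr (i, j) => om i j end) *: w k = x.
  rewrite big_sumType /=.
  transitivity (\sum_(i | s i <= 0) a i *: v i + \sum_(j | 0 < s j) a j *: v j); last first.
    rewrite -ax [RHS](bigID (fun i => s i <= 0)) /=; congr (_ + _).
    by apply: eq_bigl => i; rewrite ltNge.
  have -> : \sum_(i : 'I_n) be i *: (if s i <= 0 then v i else v i0) =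
      \sum_(i | s i <= 0) (a i * (1 - A / B)) *: v i.
    rewrite [RHS]big_mkcond /=; apply: eq_bigr => i _; rewrite /be.
    by case: ifP => // _; rewrite scale0r.
  rewrite sum_pairE /=.
  have -> : \sum_i \sum_j om i j *: w (inr (i, j)) = \sum_(i | s i <= 0)
      ((a i * (A / B)) *: v i - (a i * s i / B) *: (\sum_(j | 0 < s j) a j *: v j)).
    rewrite [RHS]big_mkcond /=; apply: eq_bigr => i _.
    case: ifPn => si; first by rewrite -(eom _ si); apply: eq_bigr => j _; rewrite /w si.
    by rewrite big1// => j _; rewrite /om (negPf si) scale0r.
  rewrite sumrB addrA -big_split /=; congr (_ + _).
    apply: eq_bigr => i _; rewrite -scalerDl; congr (_ *: _); ring.
  rewrite -scaler_suml -mulr_suml -scaleNr -[RHS]scale1r; congr (_ *: _).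
  rewrite -mulNr -(mulfV Bn0); congr (_ / _); rewrite /B; congr (- _).
  by apply: eq_bigl => i; rewrite leNgt.
exists (fun k => match k with inl i => be i | inr (i, j) => om i j end); split.
- case=> [i|[i j]].
    rewrite /be; case: ifP => // _; rewrite mulr_ge0// subr_ge0.
    by rewrite ler_pdivrMr// mul1r.
  rewrite /om; case: ifP => // /andP[si sj].
  by rewrite divr_ge0 ?(ltW Bp)// !mulr_ge0//; lra.
- rewrite big_sumType /= sum_pairE /=.
  have -> : \sum_i be i = \sum_(i | s i <= 0) a i * (1 - A / B).
    by rewrite [RHS]big_mkcond.
  have -> : \sum_i \sum_j om i j = \sum_(i | s i <= 0)
      (a i * (A / B) - a i * s i / B * \sum_(j | 0 < s j) a j).
    rewrite [RHS]big_mkcond /=; apply: eq_bigr => i _; rewrite /om.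
    case: ifPn => si /=; last by rewrite big1.
    rewrite -big_mkcond /= /A mulr_suml !mulr_sumr -sumrB.
    by apply: eq_bigr => j _; field.
  rewrite -big_split /=.
  under eq_bigr => i _ do rewrite mulrBr mulr1 addrA subrK.
  rewrite sumrB -mulr_suml -mulr_suml.
  have -> : \sum_(i | s i <= 0) a i * s i = - B.
    by rewrite /B opprK; apply: eq_bigl => i; rewrite leNgt.
  rewrite mulNr mulfV// mulN1r opprK -a1 [RHS](bigID (fun i => s i <= 0)) /=.
  by congr (_ + _); apply: eq_bigl => i; rewrite ltNge.
- by rewrite key.
Qed.

End Polytopes.

(** * Chains of mutations *)

Section Mutations.
Variables (R : realType) (T : finType).
Local Notation vec := {ffun T -> R^o}.
Local Notation ivec := {ffun T -> int}.
Implicit Types (P Q S : set vec) (x y v : vec) (w f u : ivec).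

Lemma polytope_cuts P (s : seq (vec * R)) : polytope P ->
  polytope [set x | P x /\ forall k, k \in s -> dot x k.1 <= k.2].
Proof.
move=> pP; elim: s => [|k s IH].
  suff -> : [set x | P x /\ forall k, k \in [::] -> dot x k.1 <= k.2] = P by [].
  by apply/seteqP; split=> [x []|x].
have := polytope_cut k.1 k.2 IH; congr polytope; apply/seteqP; split=> x.
  move=> [[Px H] Hk]; split=> // l; rewrite inE => /orP[/eqP ->//|]; exact: H.
move=> [Px H]; split; first split=> // l ls; apply: H.
  by rewrite inE ls orbT.
exact: mem_head.
Qed.

(** An explicit hull to start from: the restricted order polytope will be cut out of such a simplex
    by half-spaces. *)
Lemma polytope_simplex (B : R) : 0 < B ->
  polytope [set x : vec | (forall p, 0 <= x p) /\ \sum_p x p <= B].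
Proof.
move=> B0.
pose e p : vec := [ffun q => if q == p then B else 0].
apply: (@polytope_fin _ _ _ _ (fun k : 'I_1 + T => if k is inr p then e p else 0)).
- move=> x y a b [x0 xB] [y0 yB] a0 b0 ab; split=> [p|].
    by rewrite !ffunE addr_ge0// mulr_ge0.
  under eq_bigr do rewrite !ffunE.
  rewrite big_split /= -!mulr_sumr -[leRHS]mul1r -ab mulrDl.
  by apply: lerD; apply: ler_wpM2l.
- case=> [_|p]; split=> [q|]; rewrite ?ffunE//.
  + by rewrite big1 ?ltW// => q _; rewrite ffunE.
  + by case: ifP => // _; exact: ltW.
  + under eq_bigr do rewrite ffunE.
    by rewrite -big_mkcond big_pred1_eq.
- move=> x [x0 xB].
  exists (fun k => if k is inr p then x p / B else 1 - \sum_p x p / B); split.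
  + case=> [_|p]; last by rewrite divr_ge0// ltW.
    by rewrite -mulr_suml subr_ge0 ler_pdivrMr// mul1r.
  + by rewrite big_sumType big_ord_recl big_ord0 /= addr0 subrK.
  + rewrite big_sumType big_ord_recl big_ord0 /= addr0 scaler0 add0r; apply/ffunP => q.
    rewrite sum_ffunE (bigD1 q)//= !ffunE eqxx big1 ?addr0 => [|p pq].
      by rewrite /GRing.scale /= divfK// gt_eqF.
    by rewrite !ffunE eq_sym (negPf pq) scaler0.
Qed.

Definition idot f w : int := \sum_p f p * w p.

Lemma dot_int_vec f w : dot (int_vec R f) (int_vec R w) = (idot f w)%:~R.
Proof.
by rewrite /dot rmorph_sum; apply: eq_bigr => p _; rewrite !ffunE rmorphM.
Qed.

(** The gcd of the entries of [w] divides every integral pairing with [w], hence divides 1. *)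
Lemma primitive_idot f w : idot f w = 1 -> primitive_vec w.
Proof.
move=> fw; apply/eqP; rewrite -dvdn1.
set g := \big[gcdn/0%N]_p _.
have : (g%:Z %| idot f w)%Z.
  apply: rpred_sum => p _; apply: dvdz_mull.
  by rewrite dvdzE; apply: (@biggcdn_inf _ p).
by rewrite fw dvdzE.
Qed.

Definition unit_vec (p : T) : ivec := [ffun q => (q == p)%:Z].

Lemma dot_unit x p : dot x (int_vec R (unit_vec p)) = x p.
Proof.
rewrite /dot (bigD1 p)//= !ffunE eqxx mulr1 big1 ?addr0// => q qp.
by rewrite !ffunE (negPf qp) mulr0.
Qed.

Lemma idot_unit f p : idot f (unit_vec p) = f p.
Proof.
rewrite /idot (bigD1 p)//= !ffunE eqxx mulr1 big1 ?addr0// => q qp.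
by rewrite !ffunE (negPf qp) mulr0.
Qed.

Lemma idotC f w : idot f w = idot w f.
Proof. by apply: eq_bigr => p _; rewrite mulrC. Qed.

Lemma int_vecD f w : int_vec R (f + w) = int_vec R f + int_vec R w.
Proof. by apply/ffunP => p; rewrite !ffunE rmorphD. Qed.

Lemma int_vecN f : int_vec R (- f) = - int_vec R f.
Proof. by apply/ffunP => p; rewrite !ffunE rmorphN. Qed.

Lemma idotDl f1 f2 w : idot (f1 + f2) w = idot f1 w + idot f2 w.
Proof.
by rewrite /idot -big_split; apply: eq_bigr => p _; rewrite ffunE mulrDl.
Qed.

Lemma idotNl f w : idot (- f) w = - idot f w.
Proof. by rewrite /idot -sumrN; apply: eq_bigr => p _; rewrite ffunE mulNr. Qed.

Lemma primitive_unit p : primitive_vec (unit_vec p).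
Proof. by apply: (@primitive_idot (unit_vec p)); rewrite idot_unit ffunE eqxx. Qed.

(** For [f1] and [f2] orthogonal to [w], this is the inverse of the tropical map of the segment
    between them. Images under mutations thus become preimages under [toggle], which compose by
    substitution. *)
Definition toggle w f1 f2 y : vec :=
  y + Num.min (dot y (int_vec R f1)) (dot y (int_vec R f2)) *: int_vec R w.

(** That [P] is a polytope is not included; this property is propagated along a chain by
    [seg_mutation_polytope]. *)
Definition seg_mutation P Q := exists w f1 f2,
  [/\ primitive_vec w, idot f1 w = 0, idot f2 w = 0, cvx Q &
      Q = [set y | P (toggle w f1 f2 y)]].

Lemma dot_shift f w a y : idot f w = 0 ->
  dot (y + a *: int_vec R w) (int_vec R f) = dot y (int_vec R f).
Proof. by move=> fw; rewrite dotDl dotZl dot_int_vec idotC fw mulr0 addr0. Qed.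

(** A linear functional on a segment is smallest at one of the ends. *)
Lemma inf_segment f1 f2 x (F : set vec) :
  F = conv_hull (fun i : 'I_2 => int_vec R (if i == ord0 then f1 else f2)) ->
  inf [set dot x f | f in F] = Num.min (dot x (int_vec R f1)) (dot x (int_vec R f2)).
Proof.
move=> eF; set m := Num.min _ _.
have F1 : F (int_vec R f1).
  by rewrite eF; exact: (conv_hull_in (fun i : 'I_2 => int_vec R (if i == ord0 then f1 else f2)) ord0).
have F2 : F (int_vec R f2).
  by rewrite eF; exact: (conv_hull_in (fun i : 'I_2 => int_vec R (if i == ord0 then f1 else f2)) ord_max).
have lb : lbound [set dot x f | f in F] m.
  move=> _ [f Ff <-]; move: Ff; rewrite eF => -[a [a0 a1] <-].
  rewrite dotC dot_suml -[m]mul1r -a1 mulr_suml; apply: ler_sum => i _.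
  apply: ler_wpM2l => //; rewrite dotC /m.
  by case: (i == ord0); rewrite ge_min lexx ?orbT.
apply/eqP; rewrite eq_le; apply/andP; split; last first.
  by apply: lb_le_inf => //; exists (dot x (int_vec R f1)), (int_vec R f1).
have hl : has_lbound [set dot x f | f in F] by exists m.
by rewrite le_min; apply/andP; split; apply: ge_inf => //; [exists (int_vec R f1)|exists (int_vec R f2)].
Qed.

Lemma toggle_invr w f1 f2 x : idot f1 w = 0 -> idot f2 w = 0 ->
  toggle w f1 f2 (x - Num.min (dot x (int_vec R f1)) (dot x (int_vec R f2)) *: int_vec R w) = x.
Proof. by move=> h1 h2; rewrite /toggle -scaleNr !dot_shift// scaleNr subrK. Qed.

Lemma toggle_invl w f1 f2 x : idot f1 w = 0 -> idot f2 w = 0 ->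
  let y := toggle w f1 f2 x in
  y - Num.min (dot y (int_vec R f1)) (dot y (int_vec R f2)) *: int_vec R w = x.
Proof. by move=> h1 h2; rewrite /= /toggle !dot_shift// addrK. Qed.

Lemma seg_mutation_combinatorial P Q : polytope P -> seg_mutation P Q -> combinatorial_mutation P Q.
Proof.
move=> pP [w [f1 [f2 [pw h1 h2 cQ eQ]]]]; split=> //.
pose F : set vec := conv_hull (fun i : 'I_2 => int_vec R (if i == ord0 then f1 else f2)).
exists w, F; split=> //; last by apply/cvxP.
- split; last by exists (int_vec R f1); exact: (conv_hull_in (fun i : 'I_2 => int_vec R (if i == ord0 then f1 else f2)) ord0).
  by exists 2%N, (fun i : 'I_2 => if i == ord0 then f1 else f2).
- move=> _ [a _ <-] /=; rewrite dot_suml big1// => i _.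
  by rewrite dot_int_vec; case: ifP; rewrite ?h1 ?h2 mulr0.
- rewrite eQ; apply/seteqP; split=> y /=.
    move=> Py; exists (toggle w f1 f2 y) => //.
    by rewrite /tropical_map (@inf_segment f1 f2)// toggle_invl.
  move=> [x Px <-].
  by rewrite /tropical_map (@inf_segment f1 f2)// toggle_invr.
Qed.

(* The two halves of [P] on which the minimum is linear have polytopes as
   images; as the union [Q] is convex, it is the hull of their vertices. *)
Lemma seg_mutation_polytope P Q : polytope P -> seg_mutation P Q -> polytope Q.
Proof.
move=> pP [w [f1 [f2 [pw h1 h2 cQ eQ]]]].
have [n1 [v1 e1]] := polytope_cut (int_vec R (f1 - f2)) 0 pP.
have [n2 [v2 e2]] := polytope_cut (int_vec R (f2 - f1)) 0 pP.
pose g (f : ivec) x := x - dot x (int_vec R f) *: int_vec R w.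
have gD f (I : finType) (a : I -> R) (v : I -> vec) :
    g f (\sum_i a i *: v i) = \sum_i a i *: g f (v i).
  rewrite /g dot_suml scaler_suml -sumrB; apply: eq_bigr => i _.
  by rewrite scalerBr scalerA.
have dB x f f' : dot x (int_vec R (f - f')) = dot x (int_vec R f) - dot x (int_vec R f').
  by rewrite int_vecD int_vecN dotDr -scaleN1r dotZr mulN1r.
have gQ x : P x -> Q (x - Num.min (dot x (int_vec R f1)) (dot x (int_vec R f2)) *: int_vec R w).
  by rewrite eQ /= toggle_invr.
apply: (@polytope_fin _ _ _ _ (fun k : 'I_n1 + 'I_n2 =>
  match k with inl i => g f1 (v1 i) | inr i => g f2 (v2 i) end)) => //.
  case=> i.
    have := conv_hull_in v1 i; rewrite -e1 => -[/gQ].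
    by rewrite dB subr_le0 => h l; rewrite (min_l l) in h.
  have := conv_hull_in v2 i; rewrite -e2 => -[/gQ].
  by rewrite dB subr_le0 => h l; rewrite (min_r l) in h.
move=> y; rewrite eQ /=; set x := toggle w f1 f2 y => Px.
have ey := toggle_invl y h1 h2; rewrite /= -/x in ey.
have [l|/ltW l] := leP (dot x (int_vec R f1)) (dot x (int_vec R f2)).
  rewrite (min_l l) in ey.
  have : [set x | P x /\ dot x (int_vec R (f1 - f2)) <= 0] x.
    by split=> //; rewrite dB subr_le0.
  rewrite e1 => -[a [a0 a1] ax]; exists (fun k => if k is inl i then a i else 0); split.
  - by case.
  - by rewrite big_sumType /= a1 big1 ?addr0.
  - rewrite big_sumType /= [X in _ + X]big1 ?addr0 => [|i _]; last exact: scale0r.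
    by rewrite -gD ax.
rewrite (min_r l) in ey.
have : [set x | P x /\ dot x (int_vec R (f2 - f1)) <= 0] x.
  by split=> //; rewrite dB subr_le0.
rewrite e2 => -[a [a0 a1] ax]; exists (fun k => if k is inr i then a i else 0); split.
- by case.
- by rewrite big_sumType /= a1 big1 ?add0r.
- rewrite big_sumType /= [X in X + _]big1 ?add0r => [|i _]; last exact: scale0r.
  by rewrite -gD ax.
Qed.

Inductive mutation_chain : set vec -> set vec -> Prop :=
| mutation_chain_refl P : mutation_chain P P
| mutation_chain_step P Q S : seg_mutation P Q -> mutation_chain Q S -> mutation_chain P S.

Lemma mutation_chain_trans P Q S : mutation_chain P Q -> mutation_chain Q S -> mutation_chain P S.
Proof.
by elim=> // {P Q} P Q Q' h _ IH /IH; exact: mutation_chain_step.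
Qed.

Lemma mutation_chain1 P Q : seg_mutation P Q -> mutation_chain P Q.
Proof. by move=> h; apply: mutation_chain_step h _; exact: mutation_chain_refl. Qed.

Lemma mutation_chain_equivalent P Q : polytope P -> mutation_chain P Q -> mutation_equivalent P Q.
Proof.
move=> + h; elim: h => {P Q} [P pP | P Q S h _ IH pP].
  by split=> //; exists 0%N, (fun=> P); split.
have [pQ pS [s [P_ [P0 Ps Pt]]]] := IH (seg_mutation_polytope pP h).
split=> //; exists s.+1, (fun t => if t is t'.+1 then P_ t' else P); split=> //.
case=> [|t] ts; last exact: Pt.
by rewrite P0; exact: seg_mutation_combinatorial.
Qed.

(** * Shears and sign changes *)

Lemma cvx_linear_preim P (g : vec -> vec) : cvx P ->
  (forall a b x y, g (a *: x + b *: y) = a *: g x + b *: g y) ->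
  cvx [set y | P (g y)].
Proof. by move=> cP gl x y a b Px Py a0 b0 ab; rewrite /= gl; apply: cP. Qed.

Lemma shear_linear f w a b x y :
  let g y := y + dot y (int_vec R f) *: int_vec R w in
  g (a *: x + b *: y) = a *: g x + b *: g y.
Proof.
rewrite /= dotDl !dotZl scalerDl !scalerDr !scalerA.
by rewrite -!addrA; congr (_ + _); rewrite addrCA.
Qed.

(** For [f] orthogonal to [w] this is the mutation in which [F] is the point [f], so that the
    minimum is linear. *)
Definition shear f w P : set vec :=
  [set y | P (y + dot y (int_vec R f) *: int_vec R w)].

Lemma cvx_shear f w P : cvx P -> cvx (shear f w P).
Proof. by move=> cP; apply: cvx_linear_preim => // *; exact: shear_linear. Qed.

Lemma seg_mutation_shear f w P : cvx P -> primitive_vec w -> idot f w = 0 ->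
  seg_mutation P (shear f w P).
Proof.
move=> cP pw fw; exists w, f, f; split=> //; first exact: cvx_shear.
by apply/funext => y; rewrite /shear /toggle /= minxx.
Qed.

(** The set [M] between the toggle and the shear is convex because it is a linear image of [Q].
    Convexity thus has to be known only after both maps. *)
Lemma mutation_chain_toggle_shear w u f1 f2 P Q : primitive_vec w -> primitive_vec u ->
  idot f1 w = 0 -> idot f2 w = 0 -> idot f1 u = 0 -> idot f2 u = 0 ->
  cvx Q ->
  Q = [set y | P (toggle w f1 f2 y +
     (dot y (int_vec R f1) + dot y (int_vec R f2)) *: int_vec R u)] ->
  mutation_chain P Q.
Proof.
move=> pw pu w1 w2 u1 u2 cQ eQ.
pose M := [set y | P (toggle w f1 f2 y)].
have eM : M = shear (- (f1 + f2)) u Q.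
  apply/funext => y; rewrite /M /shear eQ /=; congr (P _).
  rewrite /toggle !dot_shift// int_vecN int_vecD -scaleN1r dotZr mulN1r dotDr.
  by apply/ffunP => q; rewrite !ffunE /GRing.scale /=; ring.
have eQM : Q = shear (f1 + f2) u M.
  apply/funext => y; rewrite /M /shear eQ /=; congr (P _).
  rewrite /toggle !dot_shift// int_vecD dotDr.
  by apply/ffunP => q; rewrite !ffunE /GRing.scale /=; ring.
apply: (@mutation_chain_step _ M).
  by exists w, f1, f2; split=> //; rewrite eM; exact: cvx_shear.
rewrite eQM; apply: mutation_chain1; apply: seg_mutation_shear => //.
  by rewrite eM; exact: cvx_shear.
by rewrite idotDl u1 u2.
Qed.

Definition flip (V : zmodType) (e : pred T) (x : {ffun T -> V}) : {ffun T -> V} :=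
  [ffun p => if e p then - x p else x p].

Lemma flipK (V : zmodType) (e : pred T) : involutive (@flip V e).
Proof. by move=> x; apply/ffunP => p; rewrite !ffunE; case: (e p); rewrite ?opprK. Qed.

Lemma dot_flip e x y : dot (flip e x) (flip e y) = dot x y.
Proof. by apply: eq_bigr => p _; rewrite !ffunE; case: (e p); rewrite ?mulrNN. Qed.

Lemma idot_flip e f w : idot (flip e f) (flip e w) = idot f w.
Proof. by apply: eq_bigr => p _; rewrite !ffunE; case: (e p); rewrite ?mulrNN. Qed.

Lemma int_vec_flip e w : int_vec R (flip e w) = flip e (int_vec R w).
Proof. by apply/ffunP => p; rewrite !ffunE; case: ifP; rewrite ?rmorphN. Qed.

Lemma flip_linear e a b x y :
  flip e (a *: x + b *: y) = a *: flip e x + b *: flip e y.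
Proof.
by apply/ffunP => p; rewrite !ffunE; case: ifP => //; rewrite !scalerN opprD.
Qed.

Lemma primitive_flip e w : primitive_vec w -> primitive_vec (flip e w).
Proof.
rewrite /primitive_vec => <-; apply: eq_bigr => p _.
by rewrite ffunE; case: ifP; rewrite ?abszN.
Qed.

(** A sign change is an orthogonal automorphism of the lattice, so it conjugates mutations to
    mutations. *)
Lemma seg_mutation_flip e P Q : seg_mutation P Q ->
  seg_mutation [set y | P (flip e y)] [set y | Q (flip e y)].
Proof.
move=> [w [f1 [f2 [pw h1 h2 cQ eQ]]]].
exists (flip e w), (flip e f1), (flip e f2); split.
- exact: primitive_flip.
- by rewrite idot_flip.
- by rewrite idot_flip.
- by apply: cvx_linear_preim => // *; exact: flip_linear.
rewrite eQ; apply/funext => y /=; congr (P _).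
rewrite /toggle !int_vec_flip -!(dot_flip e y) !flipK.
have := flip_linear e 1 (Num.min (dot (flip e y) (int_vec R f1)) (dot (flip e y) (int_vec R f2)))
  y (flip e (int_vec R w)).
by rewrite !scale1r flipK => <-.
Qed.

Lemma mutation_chain_flip e P Q : mutation_chain P Q ->
  mutation_chain [set y | P (flip e y)] [set y | Q (flip e y)].
Proof.
elim=> {P Q} [P|P Q S h _ IH]; first exact: mutation_chain_refl.
by apply: mutation_chain_step IH; exact: seg_mutation_flip.
Qed.

(* A sign change has determinant -1, so shears can only produce it on a proper
   linear subspace. The functional [g] vanishes on [P] because the coordinates
   [a] and [b] are constant there, and three shears in the plane spanned by
   [p] and a vector dual to [g] act on [P] as the sign change at [p]. *)
Lemma mutation_chain_flip1 P (a b p : T) (ca cb : nat) : cvx P ->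
  a != b -> p != a -> p != b -> (0 < ca)%N ->
  (forall x, P x -> x a = ca%:R /\ x b = cb%:R) ->
  mutation_chain P [set y | P (flip (pred1 p) y)].
Proof.
move=> cP ab pa pb ca0 Pab.
have [u [v uv]] := Bezoutz ca%:Z cb%:Z.
pose d := gcdz ca%:Z cb%:Z.
have d0 : d != 0 by rewrite gcdz_eq0 negb_and -lt0n ca0.
have [ca' eca] : exists z : int, ca%:Z = z * d by apply/dvdzP; rewrite dvdz_gcdl.
have [cb' ecb] : exists z : int, cb%:Z = z * d by apply/dvdzP; rewrite dvdz_gcdr.
have uv1 : u * ca' + v * cb' = 1.
  apply: (mulIf d0); rewrite mul1r mulrDl -!mulrA -eca -ecb; exact: uv.
(* [g] is the relation [cb * x a = ca * x b] divided by the gcd of [ca] and [cb], and the Bezout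
   coefficients give a [k] that pairs to 1 with it. *)
pose g : ivec := [ffun q => if q == a then cb' else if q == b then - ca' else 0].
pose k : ivec := [ffun q => if q == a then v else if q == b then - u else 0].
have ba : (b == a) = false by rewrite eq_sym (negPf ab).
have two (V : pzRingType) (h : T -> V) (al be : V) :
    \sum_q h q * (if q == a then al else if q == b then be else 0) = h a * al + h b * be.
  rewrite (bigD1 a)//= eqxx (bigD1 b) ?ba//= eqxx big1 ?addr0//.
  by move=> q /andP[/negPf -> /negPf ->]; rewrite mulr0.
have ga : g a = cb' by rewrite ffunE eqxx.
have gb : g b = - ca' by rewrite ffunE ba eqxx.
have gk : idot g k = 1.
  rewrite /idot; under eq_bigr do rewrite [k _]ffunE.
  by rewrite two ga gb -uv1; ring.
have gp : g p = 0 by rewrite ffunE (negPf pa) (negPf pb).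
have kp : k p = 0 by rewrite ffunE (negPf pa) (negPf pb).
have pk : primitive_vec k := primitive_idot gk.
have P0 x : P x -> dot x (int_vec R g) = 0.
  move=> /Pab[xa xb]; rewrite /dot.
  have -> : \sum_p0 x p0 * int_vec R g p0 = \sum_q x q *
      (if q == a then cb'%:~R else if q == b then (- ca')%:~R else 0).
    by apply: eq_bigr => q _; rewrite !ffunE; do 2 case: ifP => //.
  rewrite two xa xb !pmulrn -!intrM -intrD ecb eca.
  by apply/eqP; rewrite intr_eq0; apply/eqP; ring.
clearbody g k.
pose e := unit_vec p.
(* Three shears compose to the map from [y] to [flip (pred1 p) y - 2 gy (k + e)], where [gy] is the
   value of [g] at [y]. It negates the value of [g], so it preserves the hyperplane where [g]
   vanishes, and there it is the sign change. *)
pose P1 := shear e k P.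
pose P2 := shear (- (g + g)) e P1.
have -> : [set y | P (flip (pred1 p) y)] = shear e k P2.
  rewrite /P2 /P1 /shear; apply/funext => y /=.
  rewrite !dot_unit int_vecN -scaleN1r dotZr int_vecD dotDr dotDl dotZl dot_int_vec.
  rewrite (idotC k) gk mulr1.
  set gy := dot y (int_vec R g).
  have kpR : int_vec R k p = 0 by rewrite ffunE kp.
  have epR : int_vec R e p = 1 by rewrite !ffunE eqxx.
  rewrite !ffunE kp eqxx /= !scaler0 addr0 /GRing.scale /= mulr1.
  set z := (y + _ + _ + _).
  have zE : z = flip (pred1 p) y - (gy + gy) *: (int_vec R k + int_vec R e).
    apply/ffunP => q; rewrite !ffunE /=.
    rewrite /GRing.scale /=; case: ifP => [/eqP ->|qp] /=.
      by rewrite kp /=; ring.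
    by ring.
  have gf : dot (flip (pred1 p) y) (int_vec R g) = gy.
    apply: eq_bigr => q _; rewrite !ffunE /=; case: ifP => // /eqP ->.
    by rewrite gp !mulr0.
  have gz : dot z (int_vec R g) = - gy.
    rewrite zE dotDl gf -scaleNr dotZl dotDl !dot_int_vec (idotC k) gk.
    by rewrite (idotC e) idot_unit gp; ring.
  apply/propext; split=> [Pf|Pz].
    have gy0 : gy = 0 by rewrite -gf P0.
    by rewrite zE gy0 addr0 scale0r subr0.
  have gy0 : gy = 0 by apply: oppr_inj; rewrite -gz P0// oppr0.
  by rewrite zE gy0 addr0 scale0r subr0 in Pz.
have ek : idot e k = 0 by rewrite idotC idot_unit.
apply: (@mutation_chain_step _ P1); first exact: seg_mutation_shear.
apply: (@mutation_chain_step _ P2).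
  apply: seg_mutation_shear; [exact: cvx_shear|exact: primitive_unit|].
  by rewrite idotNl idotDl idot_unit gp addr0 oppr0.
apply: mutation_chain1; apply: seg_mutation_shear => //.
by do 2 apply: cvx_shear.
Qed.

Lemma mutation_chain_flips P (a b : T) (ca cb : nat) (e : pred T) : cvx P ->
  a != b -> ~~ e a -> ~~ e b -> (0 < ca)%N ->
  (forall x, P x -> x a = ca%:R /\ x b = cb%:R) ->
  mutation_chain P [set y | P (flip e y)].
Proof.
move=> cP ab ea eb ca0 Pab.
have H (s : seq T) : uniq s -> all e s -> mutation_chain P [set y | P (flip (mem s) y)].
  elim: s => [_ _|p s IH /andP[ps us] /andP[ep es]].
    have -> : [set y | P (flip (mem [::]) y)] = P; last exact: mutation_chain_refl.
    by apply/funext => y /=; congr (P _); apply/ffunP => q; rewrite ffunE.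
  apply: mutation_chain_trans (IH us es) _.
  have pa : p != a by apply: contraNneq ea => <-.
  have pb : p != b by apply: contraNneq eb => <-.
  have as' : a \notin s by apply: contra ea => /(allP es).
  have bs : b \notin s by apply: contra eb => /(allP es).
  have -> : [set y | P (flip (mem (p :: s)) y)] =
      [set y | [set y | P (flip (mem s) y)] (flip (pred1 p) y)].
    apply/funext => y /=; congr (P _); apply/ffunP => q; rewrite !ffunE /= inE.
    by have [->|] := eqVneq q p; rewrite //= (negPf ps).
  apply: (@mutation_chain_flip1 _ a b p ca cb) => //.
    by apply: cvx_linear_preim => // *; exact: flip_linear.
  by move=> x /= /Pab; rewrite !ffunE /= (negPf as') (negPf bs).
have := H (enum e) (enum_uniq e) _; rewrite (_ : flip (mem (enum e)) = @flip R^o e).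
  by apply; apply/allP => q; rewrite mem_enum.
by apply/funext => y; apply/ffunP => q; rewrite !ffunE /= mem_enum.
Qed.

End Mutations.

(** * The local moves of the correspondence *)

Section States.
Variable R : realType.
Local Notation grid_fun := (nat -> nat -> R).
Implicit Types (L M : nat -> nat -> bool) (X Y Z G E D : grid_fun) (k : R).

(** The empty shape is allowed, since the removal of corners ends with it. *)
Definition young M := (forall u v, M u v -> (0 < u)%N && (0 < v)%N) /\
  (forall u v a b, M u v -> (0 < a <= u)%N -> (0 < b <= v)%N -> M a b).

Definition supported L X := forall u v, ~~ L u v -> X u v = 0.

(** In the first row and column a lower neighbour lies outside the diagram, where supported fillings
    vanish, so nonnegativity is part of the condition. *)
Definition increasing M X := forall u v, M u v ->
  X u.-1 v <= X u v /\ X u v.-1 <= X u v.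

(* Truncated subtraction: the extra terms have [v - t = 0] and vanish, because
   all the fillings considered are zero outside the diagram. *)
Definition diag_sum X u v := \sum_(t < u) X (u - t)%N (v - t)%N.

(* Outside [M] the potential bounds the weight of the chains, in the manner of
   last-passage percolation. *)
Definition potential L M X k G :=
  [/\ forall u v, M u v -> G u v = X u v,
      forall u v, ~~ L u v -> G u v = 0,
      forall u v, L u v -> G u v <= k &
      forall u v, L u v -> ~~ M u v ->
        X u v + G u.-1 v <= G u v /\ X u v + G u v.-1 <= G u v].

(* [E u v] stands for the sum of the final array over the boxes below [(u, v)];
   it is left free at the boxes of [M] that are not maximal on their diagonal. *)
Definition rect_sums L M X D E :=
  [/\ forall u v, (u == 0)%N || (v == 0)%N -> E u v = 0,
      forall u v, M u v -> ~~ M u.+1 v.+1 -> E u v = diag_sum X u v,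
      forall u v, L u v -> ~~ M u v ->
        X u v = E u v + E u.-1 v.-1 - E u.-1 v - E u v.-1 &
      forall u v, L u v -> ~~ L u.+1 v.+1 -> E u v = D u v].

(* The fillings obtained when the boxes of [L] outside [M] have been removed: [X]
   is order-preserving on [M] and is an array of nonnegative weights outside.
   As projections of cones along [G] and [E], these sets are visibly convex. *)
Definition state L M X k D :=
  [/\ increasing M X, forall u v, L u v -> ~~ M u v -> 0 <= X u v,
      exists G, potential L M X k G & exists E, rect_sums L M X D E].

(* [b_r] and [a_r] of the header; at a box with a single lower neighbour, [b_r]
   is 0 and [a_r] is the value at this neighbour. *)
Definition lower_min Y u v :=
  if (1 < u)%N && (1 < v)%N then Num.min (Y u.-1 v) (Y u v.-1) else 0.

Definition lower_max Y u v := Y u.-1 v + Y u v.-1 - lower_min Y u v.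

Definition on_diag i j u v := [&& (u + j == v + i)%N, (0 < u)%N, (0 < v)%N & (u <= i)%N].

(* The inverse of the first [t] tropical maps of the move at the corner [(i, j)],
   each followed by the shear that subtracts [a_r + b_r] at [q_r]. *)
Definition theta i j t Y u v :=
  if on_diag i j u v then
    Y u v + (if (u < i)%N && (i <= u + t)%N then lower_min Y u.+1 v.+1 else 0)
          + (if (i < u + t)%N then lower_max Y u v else 0)
  else Y u v.

Definition below i j u v := on_diag i j u v && (u < i)%N.

Definition negate_below i j Y u v := if below i j u v then - Y u v else Y u v.

Definition remove i j M u v := M u v && ~~ ((u == i) && (v == j))%N.

Lemma diag_sum0l X v : diag_sum X 0 v = 0.
Proof. exact: big_ord0. Qed.

Lemma diag_sum_rec X u v : diag_sum X u.+1 v.+1 = X u.+1 v.+1 + diag_sum X u v.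
Proof.
rewrite /diag_sum big_ord_recl !subn0; congr (_ + _).
Qed.

Lemma supported0 L X u v : young L -> supported L X ->
  (u == 0)%N || (v == 0)%N -> X u v = 0.
Proof. by move=> [yL _] sX uv; apply: sX; apply: contraL uv => /yL; lia. Qed.

Lemma diag_sum0r L X u : young L -> supported L X -> diag_sum X u 0 = 0.
Proof.
by move=> yL sX; apply: big1 => t _; apply: (supported0 yL sX); rewrite orbC.
Qed.

Lemma diag_sumE L X u v : young L -> supported L X ->
  diag_sum X u v = X u v + diag_sum X u.-1 v.-1.
Proof.
move=> yL sX; case: u => [|u]; first by rewrite !diag_sum0l (supported0 yL sX)// addr0.
case: v => [|v]; last exact: diag_sum_rec.
by rewrite !(diag_sum0r _ yL sX) (supported0 yL sX) ?orbT// addr0.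
Qed.

Lemma lower_min_scale a Y u v : 0 <= a ->
  lower_min (fun u v => a * Y u v) u v = a * lower_min Y u v.
Proof. by move=> a0; rewrite /lower_min; case: ifP => _; rewrite ?mulr0// minr_pMr. Qed.

Lemma theta_scale i j t a Y : 0 <= a ->
  theta i j t (fun u v => a * Y u v) = (fun u v => a * theta i j t Y u v).
Proof.
move=> a0; apply/funext => u; apply/funext => v; rewrite /theta /lower_max.
by rewrite !lower_min_scale//; do !case: ifP => _; ring.
Qed.

Lemma state_scale L M X k D a : 0 <= a -> state L M X k D ->
  state L M (fun u v => a * X u v) (a * k) (fun u v => a * D u v).
Proof.
move=> a0 [iX pX [G [G1 G2 G3 G4]] [E [E1 E2 E3 E4]]]; split.
- by move=> u v /iX[h1 h2]; rewrite !ler_wpM2l.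
- by move=> u v h1 h2; rewrite mulr_ge0// pX.
- exists (fun u v => a * G u v); split.
  + by move=> u v /G1 ->.
  + by move=> u v /G2 ->; rewrite mulr0.
  + by move=> u v /G3 h; rewrite ler_wpM2l.
  + by move=> u v h1 h2; have [h3 h4] := G4 _ _ h1 h2; rewrite -!mulrDr !ler_wpM2l.
- exists (fun u v => a * E u v); split.
  + by move=> u v /E1 ->; rewrite mulr0.
  + by move=> u v h1 h2; rewrite E2// /diag_sum mulr_sumr.
  + by move=> u v h1 h2; rewrite E3//; ring.
  + by move=> u v h1 h2; rewrite E4.
Qed.

Lemma increasing_ge0 L M X : young L -> supported L X -> young M ->
  increasing M X -> forall u v, M u v -> 0 <= X u v.
Proof.
move=> yL sX [M0 Md] iX; elim=> [|u IH] v Muv.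
  by have := M0 _ _ Muv.
have [h1 _] := iX _ _ Muv; apply: le_trans h1 => /=.
case: (posnP u) => [->|u0]; first by rewrite (supported0 yL sX).
by apply: IH; apply: (Md _ _ _ _ Muv); have := M0 _ _ Muv; lia.
Qed.

Lemma lower_min_add Y1 Y2 u v :
  lower_min Y1 u v + lower_min Y2 u v <= lower_min (fun a b => Y1 a b + Y2 a b) u v.
Proof.
rewrite /lower_min; case: ifP => _; last by rewrite addr0.
by rewrite le_min !lerD// ge_min lexx ?orbT.
Qed.

Lemma lower_max_add Y1 Y2 u v :
  lower_max (fun a b => Y1 a b + Y2 a b) u v <= lower_max Y1 u v + lower_max Y2 u v.
Proof. by have := lower_min_add Y1 Y2 u v; rewrite /lower_max; lra. Qed.

(** * The diagonal of a corner *)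

Section Diagonal.
Variables (L : nat -> nat -> bool) (i j : nat).
Hypothesis yL : young L.
Local Notation dg := (on_diag i j).

Lemma on_diagP u v : reflect [/\ (u + j = v + i)%N, (0 < u)%N, (0 < v)%N & (u <= i)%N] (dg u v).
Proof. by apply: (iffP and4P) => -[/eqP]. Qed.

(** The neighbours of a diagonal box are off the diagonal, so a move does not change the bounds that
    it reads. *)
Lemma eq_lower_min Y Y' : (forall u v, ~~ dg u v -> Y u v = Y' u v) ->
  forall u v, dg u v -> lower_min Y u v = lower_min Y' u v /\
    lower_min Y u.+1 v.+1 = lower_min Y' u.+1 v.+1.
Proof.
move=> e u v /on_diagP[h u0 v0 ui]; rewrite /lower_min /=.
by rewrite !e//; apply/on_diagP => -[]; lia.
Qed.

Lemma eq_lower_max Y Y' : (forall u v, ~~ dg u v -> Y u v = Y' u v) ->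
  forall u v, dg u v -> lower_max Y u v = lower_max Y' u v.
Proof.
move=> e u v d; rewrite /lower_max (eq_lower_min e d).1.
by case/on_diagP: d => h u0 v0 ui; rewrite !e//; apply/on_diagP => -[]; lia.
Qed.

Lemma eq_diag_sum Y Y' : (forall u v, ~~ dg u v -> Y u v = Y' u v) ->
  forall u v, (u + j)%N <> (v + i)%N -> diag_sum Y u v = diag_sum Y' u v.
Proof.
move=> e u v h; apply: eq_bigr => t _; apply: e.
by apply/on_diagP => -[]; have := ltn_ord t; lia.
Qed.

Lemma on_diag_nbrs u v : dg u v ->
  [/\ ~~ dg u v.+1, ~~ dg u.+1 v, ~~ dg u.-1 v & ~~ dg u v.-1].
Proof. by case/on_diagP => h u0 v0 ui; split; apply/on_diagP => -[]; lia. Qed.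

Lemma theta_off t Y u v : ~~ dg u v -> theta i j t Y u v = Y u v.
Proof. by rewrite /theta => /negPf ->. Qed.

Lemma theta_on t Y u v : dg u v -> theta i j t Y u v =
  Y u v + (if (u < i)%N && (i <= u + t)%N then lower_min Y u.+1 v.+1 else 0)
        + (if (i < u + t)%N then lower_max Y u v else 0).
Proof. by rewrite /theta => ->. Qed.

Lemma theta0 Y : theta i j 0 Y = Y.
Proof.
apply/funext => u; apply/funext => v; case: (boolP (dg u v)) => d; last exact: theta_off.
rewrite (theta_on _ _ d) addn0; case/on_diagP: d => _ _ _ ui.
by rewrite (leqNgt i) andbN ltnNge ui !addr0.
Qed.

(** The diagonal has [minn i j] boxes, so the remaining indices up to [i] give no new step. *)
Lemma theta_stable t Y : (j <= t)%N || (i <= t)%N -> theta i j t.+1 Y = theta i j t Y.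
Proof.
move=> jt; apply/funext => u; apply/funext => v.
case: (boolP (dg u v)) => d; last by rewrite !theta_off.
rewrite !(theta_on _ _ d); case/on_diagP: d => h u0 v0 ui.
have -> : (i < u + t.+1)%N = (i < u + t)%N by lia.
by have -> : (i <= u + t.+1)%N = (i <= u + t)%N by lia.
Qed.

(** The step at [(i - t, j - t)] is split off on the inside, so the set for [t.+1] is a preimage of
    the set for [t]. *)
Lemma theta_succ t Y Y' : (t < i)%N -> (t < j)%N ->
  (forall u v, Y' u v = Y u v
     + (if (u == i - t)%N && (v == j - t)%N then lower_max Y (i - t) (j - t) else 0)
     + (if [&& 0 < u, 0 < v, u.+1 == i - t & v.+1 == j - t]%N
        then lower_min Y (i - t) (j - t) else 0)) ->
  theta i j t.+1 Y = theta i j t Y'.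
Proof.
move=> ti tj eY'; apply/funext => u; apply/funext => v.
have off a b : ~~ dg a b -> Y a b = Y' a b.
  move=> d; rewrite eY' !ifF ?addr0//.
    by apply: contraNF d => /and4P[a0 b0 /eqP ea /eqP eb]; apply/on_diagP; split=> //; lia.
  by apply: contraNF d => /andP[/eqP ea /eqP eb]; apply/on_diagP; split=> //; lia.
case: (boolP (dg u v)) => d; last by rewrite !theta_off// off.
rewrite !(theta_on _ _ d) -(eq_lower_max off d) -(eq_lower_min off d).2 eY'.
case/on_diagP: d => h u0 v0 ui.
have [e|ne] := eqVneq u (i - t)%N.
  have ev : v = (j - t)%N by lia.
  have -> : (i <= u + t.+1)%N by lia.
  have -> : (i <= u + t)%N by lia.
  have -> : (i < u + t.+1)%N by lia.
  have -> : (i < u + t)%N = false by lia.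
  have -> : [&& 0 < u, 0 < v, u.+1 == i - t & v.+1 == j - t]%N = false by lia.
  by rewrite ev eqxx -ev -e /=; case: ifP => _; ring.
have -> : (i < u + t.+1)%N = (i < u + t)%N by lia.
rewrite /= addr0; have [e|ne'] := eqVneq u.+1 (i - t)%N.
  have ev : v.+1 = (j - t)%N by lia.
  have -> : (u < i)%N && (i <= u + t.+1)%N by lia.
  have -> : (u < i)%N && (i <= u + t)%N = false by lia.
  by rewrite u0 v0 -ev eqxx /= e ev; ring.
have -> : (i <= u + t.+1)%N = (i <= u + t)%N by lia.
by rewrite /= !andbF addr0.
Qed.

(** Each diagonal entry below the corner is confined to an interval whose ends depend on the other
    diagonals only; the move reflects the entry in it. Nonnegativity is recorded because at the
    border [lower_max] sees a single neighbour. *)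
Definition off_increasing M X :=
  [/\ forall u v, M u v -> dg u v -> lower_max X u v <= X u v /\
        ((u < i)%N -> X u v <= lower_min X u.+1 v.+1),
      forall u v, M u v -> ~~ dg u v -> 0 <= X u v &
      forall u v, M u v -> ~~ dg u v ->
        (~~ dg u.-1 v -> X u.-1 v <= X u v) /\ (~~ dg u v.-1 -> X u v.-1 <= X u v)].

(** Applied to the shape with the corner and to the shape without it. Neither contains the two boxes
    just above the corner, so the entry there has no upper bound. *)
Lemma increasingE M X : young M -> supported L X ->
  (forall u v, M u v -> dg u v -> (u < i)%N -> M u.+1 v /\ M u v.+1) ->
  ~~ M i.+1 j -> ~~ M i j.+1 -> increasing M X <-> off_increasing M X.
Proof.
move=> yM sX Mup Mi Mj; have [M0 Md] := yM; split=> [iX | [i1 i2 i3]].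
  split=> u v Muv d.
  - split=> [|ui]; last first.
      have [M1 M2] := Mup _ _ Muv d ui.
      have [h1 _] := iX _ _ M1; have [_ h2] := iX _ _ M2.
      case/on_diagP: d => _ u0 v0 _.
      by rewrite /lower_min !ltnS u0 v0 /= le_min h1 h2.
    have [h1 h2] := iX _ _ Muv; rewrite /lower_max /lower_min.
    case: ifP => [_|uv]; first by rewrite minElt; case: ifP; lra.
    have [u1|v1] : u.-1 = 0%N \/ v.-1 = 0%N by lia.
      by rewrite [X u.-1 v](supported0 yL sX) ?u1//; lra.
    by rewrite [X u v.-1](supported0 yL sX) ?v1 ?orbT//; lra.
  - exact: (increasing_ge0 yL sX yM).
  - by have [] := iX _ _ Muv.
move=> u v Muv; have /andP[u0 v0] := M0 _ _ Muv.
have [d|nd] := boolP (dg u v).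
  have [h _] := i1 _ _ Muv d; rewrite /lower_max /lower_min in h.
  have nn a b : (0 < a <= u)%N -> (0 < b <= v)%N -> ~~ dg a b -> 0 <= X a b.
    by move=> h1 h2 h3; apply: i2 => //; exact: (Md _ _ _ _ Muv).
  have d1 : ~~ dg u.-1 v by apply/on_diagP => -[]; case/on_diagP: d; lia.
  have d2 : ~~ dg u v.-1 by apply/on_diagP => -[]; case/on_diagP: d; lia.
  move: h; case: ifP => uv.
    by rewrite minElt; case: ifP; lra.
  have n1 : 0 <= X u.-1 v.
    case: (posnP u.-1) => [->|u1]; first by rewrite (supported0 yL sX).
    by apply: nn => //; lia.
  have n2 : 0 <= X u v.-1.
    case: (posnP v.-1) => [->|v1]; first by rewrite (supported0 yL sX) ?orbT.
    by apply: nn => //; lia.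
  lra.
have [h1 h2] := i3 _ _ Muv nd; split.
  have [d|/h1//] := boolP (dg u.-1 v).
  have M1 : M u.-1 v by case/on_diagP: d => *; apply: (Md _ _ _ _ Muv); lia.
  have ui : (u.-1 < i)%N.
    rewrite ltn_neqAle; apply/andP; split; last by case/on_diagP: d.
    apply: contra Mi => /eqP e; case/on_diagP: d => *.
    by have [<- <-] : u = i.+1 /\ v = j by lia.
  have u1 : (1 < u)%N by case/on_diagP: d; lia.
  have [_ /(_ ui)] := i1 _ _ M1 d; rewrite /lower_min (prednK u0) u1 ltnS v0 /=.
  by rewrite le_min => /andP[_].
have [d|/h2//] := boolP (dg u v.-1).
have M1 : M u v.-1 by case/on_diagP: d => *; apply: (Md _ _ _ _ Muv); lia.
have ui : (u < i)%N.
  rewrite ltn_neqAle; apply/andP; split; last by case/on_diagP: d.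
  apply: contra Mj => /eqP e; case/on_diagP: d => *.
  by have [<- <-] : u = i /\ v = j.+1 by lia.
have v1 : (1 < v)%N by case/on_diagP: d; lia.
have [_ /(_ ui)] := i1 _ _ M1 d; rewrite /lower_min (prednK v0) v1 ltnS u0 /=.
by rewrite le_min => /andP[].
Qed.

End Diagonal.

(** * Convexity of the sets along one move *)

Section Corner.
Variables (L M : nat -> nat -> bool) (i j : nat).
Hypotheses (yL : young L) (yM : young M) (ML : forall u v, M u v -> L u v).
Hypotheses (Mij : M i j) (Mi : ~~ M i.+1 j) (Mj : ~~ M i j.+1).
Local Notation dg := (on_diag i j).

Lemma corner_gt0 : (0 < i)%N /\ (0 < j)%N.
Proof. by have [M0 _] := yM; have /andP[] := M0 _ _ Mij. Qed.

Lemma on_diag_corner : dg i j.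
Proof. by have [i0 j0] := corner_gt0; apply/on_diagP; split=> //; rewrite addnC. Qed.

Lemma on_diag_mem u v : dg u v -> M u v.
Proof.
move=> /on_diagP[h u0 v0 ui]; have [_ Md] := yM.
by apply: (Md _ _ _ _ Mij); lia.
Qed.

Lemma mem_on_diag u v : M u v -> (u + j)%N = (v + i)%N -> dg u v.
Proof.
move=> Muv h; have [M0 Md] := yM; have /andP[u0 v0] := M0 _ _ Muv.
apply/on_diagP; split=> //; rewrite leqNgt; apply: contra Mi => ui.
by have [_ j0] := corner_gt0; apply: (Md _ _ _ _ Muv); lia.
Qed.

Lemma on_diag_up u v : dg u v -> (u < i)%N ->
  [/\ M u.+1 v, M u v.+1 & M u.+1 v.+1].
Proof.
move=> /on_diagP[h u0 v0 _] ui; have [_ Md] := yM.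
by split; apply: (Md _ _ _ _ Mij); lia.
Qed.

Lemma on_diag_rim u v : dg u v -> ~~ M u.+1 v.+1 -> u = i /\ v = j.
Proof.
move=> d h; have ui : (i <= u)%N.
  by rewrite leqNgt; apply: contra h => ui; have [] := on_diag_up d ui.
by case/on_diagP: d; lia.
Qed.

Lemma supported_theta t Y : supported L Y -> supported L (theta i j t Y).
Proof.
move=> sY u v Luv; rewrite theta_off ?sY//.
by apply: contra Luv => /on_diag_mem /ML.
Qed.

Lemma lower_theta t Y u v : dg u v ->
  [/\ lower_min (theta i j t Y) u v = lower_min Y u v,
      lower_max (theta i j t Y) u v = lower_max Y u v &
      lower_min (theta i j t Y) u.+1 v.+1 = lower_min Y u.+1 v.+1].
Proof.
move=> d; have e a b : ~~ dg a b -> theta i j t Y a b = Y a b by exact: theta_off.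
by have [-> ->] := eq_lower_min e d; rewrite (eq_lower_max e d).
Qed.

Lemma increasing_cornerE X : supported L X ->
  increasing M X <-> off_increasing i j M X.
Proof.
move=> sX; apply: (increasingE yL) => // u v _ d ui.
by have [] := on_diag_up d ui.
Qed.

(* The terms [lower_min] are passed from each box of the diagonal to the next
   one, so they cancel in the sum of the whole diagonal. *)
Lemma diag_sum_theta_add t Y1 Y2 : supported L Y1 -> supported L Y2 ->
  let Y3 := fun u v => Y1 u v + Y2 u v in
  diag_sum (theta i j t Y3) i j =
    diag_sum (theta i j t Y1) i j + diag_sum (theta i j t Y2) i j.
Proof.
move=> s1 s2 Y3; have [i0 j0] := corner_gt0.
have s3 : supported L Y3 by move=> u v h; rewrite /Y3 s1// s2// addr0.
(* [F] is the partial diagonal sum without the [lower_min] that the next box will cancel, and this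
   quantity is additive. *)
pose F Y u v := diag_sum (theta i j t Y) u v -
  (if (i <= u + t)%N then lower_min Y u.+1 v.+1 else 0).
have HF u : forall v, (u + j)%N = (v + i)%N -> (u < i)%N -> F Y3 u v = F Y1 u v + F Y2 u v.
  elim: u => [|u IH] v h ui.
    by rewrite /F !diag_sum0l /lower_min /= !if_same; ring.
  case: v h => [|v] h.
    rewrite /F !(diag_sum0r _ yL); try exact: supported_theta.
    by rewrite /lower_min !ltnS !andbF !if_same; ring.
  have hv : (u + j = v + i)%N by lia.
  have := IH v hv (ltnW ui); rewrite /F !diag_sum_rec.
  have d : dg u.+1 v.+1 by apply/on_diagP; split=> //; lia.
  rewrite !(theta_on _ _ d) ui /= addSn ltnS /lower_max /=.
  have e1 : Y3 u.+1 v.+1 = Y1 u.+1 v.+1 + Y2 u.+1 v.+1 by [].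
  have e2 : Y3 u v.+1 = Y1 u v.+1 + Y2 u v.+1 by [].
  have e3 : Y3 u.+1 v = Y1 u.+1 v + Y2 u.+1 v by [].
  by do 2 case: ifP => _; lra.
have h1 : (i.-1 + j = j.-1 + i)%N by lia.
have h2 : (i.-1 < i)%N by lia.
have := HF i.-1 j.-1 h1 h2; rewrite /F.
have E Y : supported L Y -> diag_sum (theta i j t Y) i j =
    Y i j + (if (0 < t)%N then lower_max Y i j else 0) + diag_sum (theta i j t Y) i.-1 j.-1.
  move=> sY; rewrite (diag_sumE _ _ yL); last exact: supported_theta.
  congr (_ + _); rewrite (theta_on _ _ on_diag_corner) ltnn /= addr0.
  by have -> : (i < i + t)%N = (0 < t)%N by lia.
rewrite !E// (prednK i0) (prednK j0).
have -> : (i <= i.-1 + t)%N = (0 < t)%N by lia.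
have e1 : Y3 i j = Y1 i j + Y2 i j by [].
have e2 : Y3 i.-1 j = Y1 i.-1 j + Y2 i.-1 j by [].
have e3 : Y3 i j.-1 = Y1 i j.-1 + Y2 i j.-1 by [].
by rewrite /lower_max; case: ifP => _; lra.
Qed.

(* All the conditions are homogeneous, so that convexity reduces to additivity,
   which follows from the superadditivity of [lower_min]. *)
Lemma state_theta_add t Y1 Y2 k1 k2 D1 D2 : supported L Y1 -> supported L Y2 ->
  state L M (theta i j t Y1) k1 D1 -> state L M (theta i j t Y2) k2 D2 ->
  state L M (theta i j t (fun u v => Y1 u v + Y2 u v)) (k1 + k2)
    (fun u v => D1 u v + D2 u v).
Proof.
move=> s1 s2 [iX1 pX1 [G1 [G11 G12 G13 G14]] [E1 [E11 E12 E13 E14]]].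
move=> [iX2 pX2 [G2 [G21 G22 G23 G24]] [E2 [E21 E22 E23 E24]]].
set Y3 := fun u v => Y1 u v + Y2 u v.
have s3 : supported L Y3 by move=> u v h; rewrite /Y3 s1// s2// addr0.
have st := supported_theta t.
set X1 := theta i j t Y1 in iX1 pX1 G11 G12 G13 G14 E11 E12 E13 E14 *.
set X2 := theta i j t Y2 in iX2 pX2 G21 G22 G23 G24 E21 E22 E23 E24 *.
set X3 := theta i j t Y3.
have X3off u v : ~~ dg u v -> X3 u v = X1 u v + X2 u v.
  by move=> d; rewrite /X1 /X2 /X3 !theta_off.
have outL u v : ~~ M u v -> ~~ dg u v by apply: contra => /on_diag_mem.
have iX3 : increasing M X3.
  apply/increasing_cornerE; first exact: st.
  have [i11 i12 i13] := (increasing_cornerE (st _ s1)).1 iX1.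
  have [i21 i22 i23] := (increasing_cornerE (st _ s2)).1 iX2.
  split=> u v Muv d.
  - have [a1 b1] := i11 _ _ Muv d; have [a2 b2] := i21 _ _ Muv d.
    have [_ e1 e1'] := lower_theta t Y1 d; have [_ e2 e2'] := lower_theta t Y2 d.
    have [_ e3 e3'] := lower_theta t Y3 d.
    rewrite -/X1 e1 e1' in a1 b1; rewrite -/X2 e2 e2' in a2 b2; rewrite -/X3 e3 e3'.
    have hA := lower_max_add Y1 Y2 u v; have hB := lower_min_add Y1 Y2 u.+1 v.+1.
    rewrite -/Y3 in hA hB.
    move: a1 b1 a2 b2; rewrite /X1 /X2 /X3 /theta d.
    have y3 : Y3 u v = Y1 u v + Y2 u v by [].
    case: (ltnP u i) => ui /= a1 b1 a2 b2; last first.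
      by split=> //; move: a1 a2; case: ifP => _ a1 a2; lra.
    have {b1} b1 := b1 isT; have {b2} b2 := b2 isT.
    move: a1 b1 a2 b2; case: (leqP i (u + t)) => it /=; last first.
      have -> : (i < u + t)%N = false by lia.
      by move=> *; split=> [|_]; lra.
    by case: ifP => _ *; split=> [|_]; lra.
  - by rewrite X3off// addr_ge0 ?i12 ?i22.
  - have [l1 r1] := i13 _ _ Muv d; have [l2 r2] := i23 _ _ Muv d.
    by split=> d'; rewrite !X3off// lerD// ?l1 ?l2 ?r1 ?r2.
have X3le : X3 i j <= X1 i j + X2 i j.
  rewrite /X1 /X2 /X3 /theta on_diag_corner ltnn /=.
  have := lower_max_add Y1 Y2 i j; rewrite -/Y3.
  have y3 : Y3 i j = Y1 i j + Y2 i j by [].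
  by case: ifP => _; lra.
split=> //.
- by move=> u v Luv Muv; rewrite X3off ?outL// addr_ge0 ?pX1 ?pX2.
(* On [M] the potential is forced to be the filling, which is not additive on the diagonal;
   elsewhere the sum of the two potentials serves. *)
- exists (fun u v => if M u v then X3 u v else G1 u v + G2 u v); split.
  + by move=> u v ->.
  + move=> u v Luv; have /negPf -> : ~~ M u v by apply: contra Luv; exact: ML.
    by rewrite G12// G22// addr0.
  + move=> u v Luv; case: ifP => [Muv|_]; last by rewrite lerD ?G13 ?G23.
    have [d|d] := boolP (dg u v); last first.
      by rewrite X3off// lerD// -?G11 -?G21// ?G13 ?G23.
    have [ui|ui] := ltnP u i.
      have [M1 M2 _] := on_diag_up d ui.
      have [_] := iX3 _ _ M2; move/le_trans; apply.
      have nd : ~~ dg u v.+1.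
        by apply/on_diagP => -[]; case/on_diagP: d; lia.
      by rewrite X3off// -G11// -G21// lerD ?G13 ?G23 ?ML.
    have [-> ->] : u = i /\ v = j by case/on_diagP: d; lia.
    by apply: le_trans X3le _; rewrite -G11// -G21// lerD ?G13 ?G23 ?ML.
  + move=> u v Luv Muv; rewrite (negPf Muv) X3off ?outL//.
    (* A lower neighbour of a removed box is outside [M] or last on its diagonal in [M]. On the
       diagonal of the corner the only such box of [M] is the corner, where [X3le] applies. *)
    have H a b : ~~ M a b || ~~ M a.+1 b.+1 ->
        (if M a b then X3 a b else G1 a b + G2 a b) <= G1 a b + G2 a b.
      case: ifP => //= Mab Mab1; rewrite G11// G21//.
      have [d|d] := boolP (dg a b); last by rewrite X3off.
      by have [-> ->] := on_diag_rim d Mab1.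
    have [[h1 h2] [h3 h4]] := (G14 _ _ Luv Muv, G24 _ _ Luv Muv).
    have /andP[u0 v0] := yL.1 _ _ Luv.
    have Mn a b : (u <= a)%N -> (v <= b)%N -> ~~ M a b.
      move=> ua vb; apply: contra Muv => Mab; by apply: (yM.2 _ _ _ _ Mab); rewrite ?u0 ?v0.
    have m1 : ~~ M u.-1 v || ~~ M u.-1.+1 v.+1 by rewrite prednK// (Mn u v.+1)// orbT.
    have m2 : ~~ M u v.-1 || ~~ M u.+1 v.-1.+1 by rewrite prednK// (Mn u.+1 v)// orbT.
    by have := H _ _ m1; have := H _ _ m2; lra.
- exists (fun u v => E1 u v + E2 u v); split.
  + by move=> u v h; rewrite E11// E21// addr0.
  + move=> u v Muv Muv1; rewrite E12// E22//.
    have [h|h] := eqVneq (u + j)%N (v + i)%N.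
      have [-> ->] := on_diag_rim (mem_on_diag Muv h) Muv1.
      by rewrite -diag_sum_theta_add.
    have e Y a b : ~~ dg a b -> theta i j t Y a b = Y a b by exact: theta_off.
    rewrite /X1 /X2 /X3 !(eq_diag_sum (e _)); try exact/eqP.
    by rewrite /diag_sum -big_split.
  + move=> u v Luv Muv; rewrite X3off ?outL// E13// E23//; ring.
  + by move=> u v Luv Luv1; rewrite E14// E24.
Qed.

Lemma young_remove : young (remove i j M).
Proof.
split=> [u v /andP[/(yM.1 _ _)//]|u v a b /andP[Muv nuv] ha hb].
rewrite /remove (yM.2 _ _ _ _ Muv ha hb); apply: contra nuv => /andP[/eqP ea /eqP eb].
move: ha hb; rewrite ea eb => /andP[i0 iu] /andP[j0 jv].
have -> : (u == i).
  rewrite eqn_leq iu andbT leqNgt; apply: contra Mi => ui.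
  by apply: (yM.2 _ _ _ _ Muv); rewrite ?j0.
rewrite eqn_leq jv andbT leqNgt; apply: contra Mj => vj.
by apply: (yM.2 _ _ _ _ Muv); rewrite ?i0.
Qed.

Definition corner_nbr a b := (a = i.-1 /\ b = j) \/ (a = i /\ b = j.-1).

Lemma corner_nbrP a b : corner_nbr a b ->
  [/\ ~~ dg a b, (a + j)%N <> (b + i)%N, ~~ M a.+1 b.+1 &
     ((a == 0) || (b == 0))%N \/ M a b].
Proof.
have [i0 j0] := corner_gt0; move=> h; split.
- by apply/on_diagP => -[]; case: h; lia.
- by case: h; lia.
- by case: h => -[-> ->]; rewrite (prednK i0, prednK j0).
- have [ab|ab] := boolP ((a == 0) || (b == 0))%N; [by left|right].
  by apply: (yM.2 _ _ _ _ Mij); case: h; lia.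
Qed.

(** * Removal of a corner *)

Section Remove.
Variable Y : grid_fun.
Hypothesis sY : supported L Y.
(** [X] is the filling before the move and [Z] the filling after it. The tropical maps lead to [Y],
    which agrees with [Z] up to the signs below the corner. *)
Let X := theta i j i Y.
Let Z := negate_below i j Y.
Local Notation N := (remove i j M).

Let Xoff u v : ~~ dg u v -> X u v = Y u v.
Proof. exact: theta_off. Qed.

Let Zoff u v : ~~ dg u v -> Z u v = Y u v.
Proof. by rewrite /Z /negate_below /below => /negPf ->. Qed.

Let Xbelow u v : dg u v -> (u < i)%N ->
  X u v = lower_min Y u.+1 v.+1 + lower_max Y u v - Z u v.
Proof.
move=> d ui; rewrite /X (theta_on _ _ d) /Z /negate_below /below d ui leq_addl /=.
have -> : (i < u + i)%N by case/on_diagP: d; lia.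
by ring.
Qed.

Let Xcorner : X i j = lower_max Y i j + Z i j.
Proof.
have [i0 _] := corner_gt0.
rewrite /X (theta_on _ _ on_diag_corner) /Z /negate_below /below ltnn andbF /=.
have -> : (i < i + i)%N by lia.
by rewrite addr0 addrC.
Qed.

Let sX : supported L X.
Proof. exact: supported_theta. Qed.

Let sZ : supported L Z.
Proof.
move=> u v h; rewrite Zoff ?sY//.
by apply: contra h => /on_diag_mem /ML.
Qed.

Let N_off u v : ~~ dg u v -> N u v = M u v.
Proof.
move=> d; rewrite /remove; case: (M u v) => //=.
by apply: contra d => /andP[/eqP -> /eqP ->]; exact: on_diag_corner.
Qed.

Let N_on u v : dg u v -> N u v = (u < i)%N.
Proof.
move=> d; rewrite /remove (on_diag_mem d) /= ltn_neqAle.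
by case/on_diagP: d => h _ _ ->; rewrite andbT; congr (~~ _); lia.
Qed.

Let NM u v : N u v -> M u v.
Proof. by case/andP. Qed.

Let lowerZ u v : dg u v -> [/\ lower_min Z u v = lower_min Y u v,
  lower_max Z u v = lower_max Y u v & lower_min Z u.+1 v.+1 = lower_min Y u.+1 v.+1].
Proof. by move=> d; have [-> ->] := eq_lower_min Zoff d; rewrite (eq_lower_max Zoff d). Qed.

Let increasing_removeE : increasing N Z <-> off_increasing i j N Z.
Proof.
apply: (increasingE yL) => //; first exact: young_remove.
- move=> u v _ d ui; have [M1 M2 _] := on_diag_up d ui.
  by rewrite !N_off ?M1 ?M2//; apply/on_diagP => -[]; case/on_diagP: d; lia.
- by apply: contra Mi => /NM.
- by apply: contra Mj => /NM.
Qed.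

(** Reflection maps the interval of an entry to itself. At the corner there is only the lower bound
    [lower_max], and subtracting it leaves nonnegativity. *)
Lemma increasing_remove : increasing M X <-> increasing N Z /\ 0 <= Z i j.
Proof.
rewrite increasing_cornerE// increasing_removeE; split=> [[h1 h2 h3]|[[h1 h2 h3] h0]].
- split; first split=> u v.
  + move=> Nuv d; have ui : (u < i)%N by rewrite -(N_on d).
    have [a1 /(_ ui)] := h1 _ _ (NM Nuv) d.
    have [_ -> ->] := lowerZ d; have [_ e1 ->] := lower_theta i Y d.
    by move: a1; rewrite e1 Xbelow// => a1 a2; split=> [|_]; lra.
  + by move=> Nuv d; rewrite Zoff// -Xoff// h2// NM.
  + move=> Nuv d; have [a1 a2] := h3 _ _ (NM Nuv) d.
    by split=> d'; rewrite !Zoff// -!Xoff//; [exact: a1|exact: a2].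
  + have [a1 _] := h1 _ _ Mij on_diag_corner.
    move: a1; have [_ -> _] := lower_theta i Y on_diag_corner.
    by rewrite Xcorner; lra.
- split=> u v.
  + move=> Muv d; have [_ -> ->] := lower_theta i Y d.
    have [ui|ui] := ltnP u i; last first.
      have [-> ->] : u = i /\ v = j by case/on_diagP: d; lia.
      by rewrite Xcorner; split=> //; lra.
    have Nuv : N u v by rewrite N_on.
    have [a1 /(_ ui)] := h1 _ _ Nuv d; move: a1.
    by have [_ -> ->] := lowerZ d; rewrite Xbelow// => a1 a2; split=> [|_]; lra.
  + by move=> Muv d; rewrite Xoff// -Zoff// h2// N_off.
  + move=> Muv d; rewrite -(N_off d) in Muv; have [a1 a2] := h3 _ _ Muv d.
    by split=> d'; rewrite !Xoff// -!Zoff//; [exact: a1|exact: a2].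
Qed.

(* Inclusion-exclusion for the rectangle below the corner. *)
Lemma diag_sum_remove : diag_sum X i j + diag_sum Z i.-1 j.-1 =
  Z i j + diag_sum Y i.-1 j + diag_sum Y i j.-1.
Proof.
have [i0 j0] := corner_gt0.
(* Along the diagonal, inclusion-exclusion holds up to the [lower_min] at the next box, which
   cancels in the next step. *)
have H u : forall v, (u + j)%N = (v + i)%N -> (u < i)%N ->
    diag_sum X u v + diag_sum Z u v =
    diag_sum Y u.-1 v + diag_sum Y u v.-1 + lower_min Y u.+1 v.+1.
  elim: u => [|u IH] v h ui.
    by rewrite !diag_sum0l /lower_min /=; ring.
  case: v h => [|v] h.
    by rewrite !(diag_sum0r _ yL)// /lower_min !ltnS !andbF; ring.
  have hv : (u + j = v + i)%N by lia.
  have := IH v hv (ltnW ui); rewrite !diag_sum_rec.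
  have d : dg u.+1 v.+1 by apply/on_diagP; split=> //; lia.
  rewrite Xbelow// /lower_max /= [diag_sum Y u v.+1](diag_sumE _ _ yL)//.
  by rewrite [diag_sum Y u.+1 v](diag_sumE _ _ yL)//=; lra.
have h1 : (i.-1 + j.-1.+1 = j.-1.+1 + i.-1)%N by lia.
have := H i.-1 j.-1; rewrite (prednK i0) (prednK j0) => /(_ _ _) h.
have {h} : diag_sum X i.-1 j.-1 + diag_sum Z i.-1 j.-1 =
  diag_sum Y i.-2 j.-1 + diag_sum Y i.-1 j.-2 + lower_min Y i j by apply: h; lia.
rewrite [diag_sum X i j](diag_sumE _ _ yL)// Xcorner /lower_max.
rewrite [diag_sum Y i.-1 j](diag_sumE _ _ yL)// [diag_sum Y i j.-1](diag_sumE _ _ yL)//.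
by lra.
Qed.

(** Monotonicity is [increasing_remove]. The relation between [X i j] and [Z i j] is the
    last-passage recursion at the corner, and [diag_sum_remove] turns the diagonal sum at the corner
    into the inclusion-exclusion condition on [E] there. *)
Lemma state_remove k D : state L M X k D <-> state L N Z k D.
Proof.
have [i0 j0] := corner_gt0.
have Nij : N i j = false by rewrite /remove !eqxx andbF.
have Lij : L i j := ML Mij.
have [_ _ d1 d2] := on_diag_nbrs on_diag_corner.
have nl : corner_nbr i.-1 j by left.
have nd : corner_nbr i j.-1 by right.
have ub u v : L u v -> ~~ M u v -> [/\ ~~ dg u v, ~~ below i j u.-1 v & ~~ below i j u v.-1].
  move=> Luv Muv; have /andP[u0 v0] := yL.1 _ _ Luv.
  split; first by apply: contra Muv => /on_diag_mem.
    apply: contra Muv => /andP[d ui]; have [+ _ _] := on_diag_up d ui.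
    by rewrite prednK.
  apply: contra Muv => /andP[d ui]; have [_ + _] := on_diag_up d ui.
  by rewrite prednK.
have Nb u v : N u v -> ~~ below i j u v -> ~~ dg u v.
  by move=> Nuv; rewrite /below; case: (boolP (dg u v)) => //= d; rewrite -(N_on d) Nuv.
have bN u v : below i j u v -> N u v by case/andP => d ui; rewrite N_on.
have Zlow u v : ~~ below i j u v -> Z u v = Y u v by rewrite /Z /negate_below => /negPf ->.
have notN u v : ~~ N u v -> M u v -> u = i /\ v = j.
  by rewrite /remove => + Muv; rewrite Muv negbK => /andP[/eqP -> /eqP ->].
have bdY u v : ((u == 0) || (v == 0))%N -> Y u v = 0 by exact: (supported0 yL sY).
have Ycor a b : increasing M X -> corner_nbr a b -> 0 <= Y a b.
  move=> iX /corner_nbrP[dab _ _ [/bdY ->//|Mab]].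
  by rewrite -Xoff//; exact: (increasing_ge0 yL sX yM iX).
have rim1 u v : M u v -> ~~ M u.+1 v.+1 -> (u, v) <> (i, j) -> ~~ dg u v.
  by move=> Muv h ne; apply/negP => d; apply: ne; have [-> ->] := on_diag_rim d h.
have dsX u v : (u + j)%N <> (v + i)%N -> diag_sum X u v = diag_sum Y u v by apply: eq_diag_sum.
have dsZ u v : (u + j)%N <> (v + i)%N -> diag_sum Z u v = diag_sum Y u v by apply: eq_diag_sum.
have Mne u v : M u v -> ~~ dg u v -> (u + j)%N <> (v + i)%N.
  by move=> Muv; apply: contraNnot; exact: mem_on_diag.
have key := diag_sum_remove.
split=> [[iX pX [G [G1 G2 G3 G4]] [E [E1 E2 E3 E4]]] | [iZ pZ [G [G1 G2 G3 G4]] [E [E1 E2 E3 E4]]]].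
- have [iZ Z0] := increasing_remove.1 iX.
  split=> //.
  + move=> u v Luv; have [Muv|Muv _] := boolP (M u v).
      by move=> /notN/(_ Muv)[-> ->].
    by have [d _ _] := ub _ _ Luv Muv; rewrite Zoff// -Xoff// pX.
  (* The potential keeps the value [X i j] at the corner, which is [Z i j] plus the maximum of the
     lower neighbours. *)
  + exists (fun u v => if N u v then Z u v else G u v); split.
    * by move=> u v ->.
    * move=> u v Luv; rewrite ifF ?G2//; apply: contraNF Luv => /NM; exact: ML.
    * move=> u v Luv; case: ifP => [Nuv|_]; last exact: G3.
      have [/andP[d ui]|b] := boolP (below i j u v); last first.
        by rewrite Zoff ?Nb// -Xoff ?Nb// -G1 ?NM// G3.
      have [M1 M2 _] := on_diag_up d ui.
      have [nd' _ _ _] := on_diag_nbrs d.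
      have N2 : N u v.+1 by rewrite N_off.
      have [_] := iZ _ _ N2; move/le_trans; apply.
      by rewrite Zoff// -Xoff// -G1// G3 ?ML.
    * move=> u v Luv Nuv; rewrite (negPf Nuv).
      have [Muv|Muv] := boolP (M u v).
        have [-> ->] := notN _ _ Nuv Muv.
        have gl a b : corner_nbr a b ->
            (if N a b then Z a b else G a b) = Y a b.
          move=> /corner_nbrP[dab _ _ hab].
          case: (boolP (M a b)) => Mab; first by rewrite N_off// Mab Zoff.
          have {hab} ab0 : ((a == 0) || (b == 0))%N by case: hab => //; rewrite (negPf Mab).
          rewrite N_off// (negPf Mab) bdY// G2//.
          by apply: contraL ab0 => /(yL.1 _ _) /andP[]; rewrite !lt0n negb_or => -> ->.
        rewrite !gl//.
        rewrite G1// -[Z i j](addKr (lower_max Y i j)) -Xcorner.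
        have [h1 h2] := iX _ _ Mij; rewrite (Xoff d1) in h1; rewrite (Xoff d2) in h2.
        move: h1 h2; rewrite Xcorner /lower_max /lower_min => h1 h2.
        have p1 := Ycor _ _ iX nl; have p2 := Ycor _ _ iX nd.
        move: h1 h2; case: ifP => _; last by split; lra.
        by rewrite minElt; case: ifP; split; lra.
      have [d b1 b2] := ub _ _ Luv Muv; rewrite Zoff//.
      have gg a b : ~~ below i j a b -> (if N a b then Z a b else G a b) = G a b.
        move=> bab; case: ifP => // Nab.
        by rewrite G1 ?NM// Zoff ?Nb// Xoff ?Nb.
      by rewrite !gg// -Xoff//; apply: G4.
  (* Without the corner, [(i.-1, j.-1)] becomes the last box of its diagonal, so its value of [E],
     free until now, is prescribed. *)
  + exists (fun u v => if (u == i.-1) && (v == j.-1) then diag_sum Z i.-1 j.-1 else E u v).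
    have E' u v : (u, v) <> (i.-1, j.-1) ->
        (if (u == i.-1) && (v == j.-1) then diag_sum Z i.-1 j.-1 else E u v) = E u v.
      by move=> ne; case: ifP => // /andP[/eqP eu /eqP ev]; case: ne; rewrite eu ev.
    have EY a b : corner_nbr a b -> E a b = diag_sum Y a b.
      move=> /corner_nbrP[dab nab rab [ab0|Mab]]; last by rewrite E2 ?dsX.
      rewrite E1//; case/orP: ab0 => /eqP ->; first by rewrite diag_sum0l.
      by rewrite (diag_sum0r _ yL sY).
    split.
    * move=> u v h; case: ifP => [/andP[/eqP eu /eqP ev]|_]; last exact: E1.
      move: h; rewrite eu ev => /orP[/eqP ->|/eqP ->]; first by rewrite diag_sum0l.
      by rewrite (diag_sum0r _ yL).
    * move=> u v Nuv N1; case: ifP => [/andP[/eqP -> /eqP ->]//|ne].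
      have M1 : ~~ M u.+1 v.+1.
        apply: contraFN ne => /(notN _ _ N1)[<- <-] /=; by rewrite !eqxx.
      have nd' : ~~ dg u v.
        apply: rim1 (NM Nuv) M1 _ => -[eu ev]; by rewrite eu ev Nij in Nuv.
      have ne' := Mne _ _ (NM Nuv) nd'.
      by rewrite (E2 _ _ (NM Nuv) M1) (dsX _ _ ne') (dsZ _ _ ne').
    * move=> u v Luv Nuv; have /andP[u0 v0] := yL.1 _ _ Luv.
      have [Muv|Muv] := boolP (M u v).
        have [-> ->] := notN _ _ Nuv Muv.
        rewrite (E' i j) ?(E' i.-1 j) ?(E' i j.-1); try by clear -i0 j0; case; lia.
        rewrite !eqxx /=.
        have M1 : ~~ M i.+1 j.+1.
          by apply: contra Mi => h; apply: (yM.2 _ _ _ _ h); rewrite ?j0 ?leqnn ?leqnSn.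
        by rewrite (EY _ _ nl) (EY _ _ nd) E2//; lra.
      have [d _ _] := ub _ _ Luv Muv.
      have uv : ~~ ((u <= i)%N && (v <= j)%N).
        by apply: contra Muv => /andP[ui vj]; apply: (yM.2 _ _ _ _ Mij); rewrite ?u0 ?v0.
      rewrite Zoff// -Xoff// E3// !E'//; clear -i0 j0 u0 v0 uv; case; lia.
    * move=> u v Luv L1; rewrite E' ?E4// => -[eu ev].
      by move: L1; rewrite eu ev !prednK// Lij.
- have Z0 : 0 <= Z i j by apply: pZ; rewrite ?Nij.
  have iX : increasing M X by apply/increasing_remove.
  split=> //.
  + move=> u v Luv Muv; have [d _ _] := ub _ _ Luv Muv.
    rewrite Xoff// -Zoff// pZ//; apply: contra Muv; exact: NM.
  + have GXij : X i j <= G i j.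
      have [h1 h2] := G4 i j Lij (negbT Nij).
      have gl a b : corner_nbr a b -> G a b = Y a b.
        move=> /corner_nbrP[dab _ _ [ab0|Mab]]; last by rewrite G1 ?N_off// Zoff.
        rewrite bdY// G2//.
        by apply: contraL ab0 => /(yL.1 _ _) /andP[]; rewrite !lt0n negb_or => -> ->.
      rewrite (gl _ _ nl) in h1; rewrite (gl _ _ nd) in h2.
      have p1 := Ycor _ _ iX nl; have p2 := Ycor _ _ iX nd.
      rewrite Xcorner /lower_max /lower_min; case: ifP => ij.
        by rewrite minElt; case: ifP; lra.
      have [a0|a0] : i.-1 = 0%N \/ j.-1 = 0%N by clear -ij; lia.
        by rewrite [Y i.-1 j]bdY ?a0//; lra.
      by rewrite [Y i j.-1]bdY ?a0 ?orbT//; lra.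
    (* [G i j] may exceed [X i j]. Lowering it only weakens the conditions at the boxes outside [M],
       where it enters as the value at a lower neighbour. *)
    exists (fun u v => if M u v then X u v else G u v); split.
    * by move=> u v ->.
    * move=> u v Luv; rewrite ifF ?G2//; apply: contraNF Luv; exact: ML.
    * move=> u v Luv; case: ifP => [Muv|_]; last exact: G3.
      have [d|d] := boolP (dg u v); last first.
        by rewrite Xoff// -Zoff// -G1 ?N_off// G3.
      have [ui|ui] := ltnP u i.
        have [M1 M2 _] := on_diag_up d ui.
        have [nd' _ _ _] := on_diag_nbrs d.
        have [_] := iX _ _ M2; move/le_trans; apply.
        by rewrite Xoff// -Zoff// -G1 ?N_off// G3 ?ML.
      have [-> ->] : u = i /\ v = j by case/on_diagP: d => h _ _ h'; clear -h h' ui; lia.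
      by apply: le_trans GXij _; exact: G3.
    * move=> u v Luv Muv; rewrite (negPf Muv).
      have Nuv : ~~ N u v by apply: contra Muv; exact: NM.
      have [d b1 b2] := ub _ _ Luv Muv.
      have gg a b : ~~ below i j a b -> (if M a b then X a b else G a b) <= G a b.
        move=> bab; case: ifP => // Mab.
        have [/notN/(_ Mab)[-> ->]//|Nab] := boolP (~~ N a b).
        move/negbNE: Nab => Nab; have dab := Nb _ _ Nab bab.
        by rewrite (G1 _ _ Nab) (Zoff dab) (Xoff dab).
      have [h1 h2] := G4 _ _ Luv Nuv; rewrite Xoff//; rewrite Zoff// in h1 h2.
      by have := gg _ _ b1; have := gg _ _ b2; split; lra.
  + exists E.
    have EY a b : corner_nbr a b -> E a b = diag_sum Y a b.
      move=> /corner_nbrP[dab nab rab [ab0|Mab]].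
        rewrite E1//; case/orP: ab0 => /eqP ->; first by rewrite diag_sum0l.
        by rewrite (diag_sum0r _ yL sY).
      have Nab : N a b by rewrite N_off.
      have Nab1 : ~~ N a.+1 b.+1 by apply: contra rab; exact: NM.
      by rewrite (E2 _ _ Nab Nab1) dsZ.
    split=> //.
    * move=> u v Muv M1; have [Nuv|/notN/(_ Muv)[eu ev]] := boolP (N u v).
        have nd' : ~~ dg u v.
          apply: rim1 Muv M1 _ => -[eu ev]; by rewrite eu ev Nij in Nuv.
        have ne' := Mne _ _ Muv nd'.
        rewrite (dsX _ _ ne') -(dsZ _ _ ne'); apply: E2 => //.
        by apply: contra M1; exact: NM.
      subst u v.
      have Eq : E i.-1 j.-1 = diag_sum Z i.-1 j.-1.
        have [ab0|ab0] := boolP ((i.-1 == 0) || (j.-1 == 0))%N.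
          rewrite E1//; case/orP: ab0 => /eqP ->; first by rewrite diag_sum0l.
          by rewrite (diag_sum0r _ yL).
        have d : dg i.-1 j.-1 by clear -i0 j0 ab0; apply/on_diagP; split; lia.
        have N1 : N i.-1 j.-1 by rewrite (N_on d) prednK.
        by rewrite E2// (prednK i0) (prednK j0) Nij.
      have := E3 i j Lij (negbT Nij).
      by rewrite Eq (EY _ _ nl) (EY _ _ nd); lra.
    * move=> u v Luv Muv; have [d _ _] := ub _ _ Luv Muv.
      rewrite Xoff// -Zoff// E3//; apply: contra Muv; exact: NM.
Qed.

End Remove.
End Corner.
End States.

(** * Realization of the local moves by mutations *)

Section Diagram.
Variables (R : realType) (lam : {fset grid}).
Local Notation vec := {ffun lam -> R^o}.
Local Notation ivec := {ffun lam -> int}.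

Definition cell u v : bool := ((u, v) : grid) \in lam.

Definition ext (x : vec) (u v : nat) : R :=
  if insub ((u, v) : grid) is Some p then x p else 0.

Lemma ext_val x (p : lam) : ext x (val p).1 (val p).2 = x p.
Proof. by rewrite /ext -surjective_pairing valK. Qed.

Lemma ext_cell x u v (h : cell u v) : ext x u v = x (FSetSub h).
Proof. by rewrite /ext insubT. Qed.

Lemma cell_val (p : lam) : cell (val p).1 (val p).2.
Proof. by rewrite /cell -surjective_pairing; exact: valP. Qed.

Lemma supported_ext x : supported cell (ext x).
Proof. by move=> u v h; rewrite /ext insubF//; exact: negbTE. Qed.

Lemma ext_linear a b x y u v : ext (a *: x + b *: y) u v = a * ext x u v + b * ext y u v.
Proof.
rewrite /ext; case: insub => [p|]; first by rewrite !ffunE.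
by rewrite !mulr0 addr0.
Qed.

Lemma ext_add a x y u v : ext (x + a *: y) u v = ext x u v + a * ext y u v.
Proof. by have := ext_linear 1 a x y u v; rewrite scale1r mul1r. Qed.

(** Zero outside the diagram, in agreement with [ext], so that missing neighbours need no separate
    treatment. *)
Definition box_vec a b : ivec := [ffun p => (val p == (a, b))%:Z].

Lemma box_vec_cell a b (h : cell a b) : box_vec a b = unit_vec (FSetSub h).
Proof. by apply/ffunP => p; rewrite !ffunE. Qed.

Lemma box_vec_out a b : ~~ cell a b -> box_vec a b = 0.
Proof.
move=> h; apply/ffunP => p; rewrite !ffunE; case: eqP => // e.
by move: h; rewrite /cell -e; have -> : val p \in lam by exact: valP.
Qed.

Lemma dot_box x a b : dot x (int_vec R (box_vec a b)) = ext x a b.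
Proof.
have [h|h] := boolP (cell a b); first by rewrite box_vec_cell dot_unit ext_cell.
rewrite supported_ext// box_vec_out// /dot big1// => p _.
by rewrite !ffunE mulr0.
Qed.

Lemma idot_box f a b (h : cell a b) : idot f (box_vec a b) = f (FSetSub h).
Proof. by rewrite box_vec_cell idot_unit. Qed.

Lemma idot_box_box a b a' b' : (a, b) <> (a', b') -> idot (box_vec a b) (box_vec a' b') = 0.
Proof.
move=> ne; apply: big1 => p _; rewrite !ffunE.
by case: eqP => [->|]; [case: eqP => // e; case: ne|rewrite mul0r].
Qed.

Lemma idot_box_self a b : cell a b -> idot (box_vec a b) (box_vec a b) = 1.
Proof. by move=> h; rewrite (idot_box _ h) ffunE /= eqxx. Qed.

Lemma idotDr (f w w' : ivec) : idot f (w + w') = idot f w + idot f w'.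
Proof. by rewrite !(idotC f) idotDl. Qed.

Lemma idotNr (f w : ivec) : idot f (- w) = - idot f w.
Proof. by rewrite !(idotC f) idotNl. Qed.

Lemma ext_box a b u v : cell a b ->
  ext (int_vec R (box_vec a b)) u v = ((u == a) && (v == b))%:R.
Proof.
move=> h; rewrite /ext; case: insubP => [p _ e|].
  by rewrite !ffunE e xpair_eqE; case: (_ && _).
by move=> nuv; case: andP => // -[/eqP eu /eqP ev]; case/negP: nuv; rewrite eu ev.
Qed.

(** * The mutations of one move *)

Section Step.
Variables (M : nat -> nat -> bool) (i j : nat) (k : R) (D : nat -> nat -> R).
Hypotheses (yL : young cell) (yM : young M) (ML : forall u v, M u v -> cell u v).
Hypotheses (Mij : M i j) (Mi : ~~ M i.+1 j) (Mj : ~~ M i j.+1).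

Definition state_set N : set vec := [set y | state cell N (ext y) k D].

Definition theta_set t : set vec := [set y | state cell M (theta i j t (ext y)) k D].

(** Both points are scaled by their weights and added; [k] and [D] are recovered because the weights
    sum to 1. *)
Lemma cvx_theta_set t : cvx (theta_set t).
Proof.
move=> x y a b Vx Vy a0 b0 ab; rewrite /theta_set /=.
have -> : ext (a *: x + b *: y) = fun u v => a * ext x u v + b * ext y u v.
  by apply/funext => u; apply/funext => v; exact: ext_linear.
have sc c z : supported cell (fun u v => c * ext z u v).
  by move=> u v h; rewrite supported_ext// mulr0.
have st c z : theta_set t z -> 0 <= c ->
    state cell M (theta i j t (fun u v => c * ext z u v)) (c * k) (fun u v => c * D u v).
  by move=> Vz c0; rewrite theta_scale//; exact: state_scale.
have := state_theta_add yL yM ML Mij Mi Mj (sc a x) (sc b y) (st a x Vx a0) (st b y Vy b0).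
rewrite -mulrDl ab mul1r; congr (state _ _ _ _ _).
by apply/funext => u; apply/funext => v; rewrite -mulrDl ab mul1r.
Qed.

Lemma mutation_chain_theta_set t : (t < i)%N -> mutation_chain (theta_set t) (theta_set t.+1).
Proof.
move=> ti; have [jt|tj] := leqP j t.
  suff -> : theta_set t.+1 = theta_set t by exact: mutation_chain_refl.
  by rewrite /theta_set; apply/funext => y; rewrite /= theta_stable ?jt.
set a := (i - t)%N; set b := (j - t)%N.
have a0 : (0 < a)%N by rewrite subn_gt0.
have b0 : (0 < b)%N by rewrite subn_gt0.
have Lab : cell a b by apply: ML; apply: (yM.2 _ _ _ _ Mij); rewrite ?a0 ?b0 leq_subr.
pose e := box_vec a b.
pose f1 := box_vec a.-1 b; pose f2 := box_vec a b.-1.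
have f1e : idot f1 e = 0 by apply: idot_box_box => -[]; lia.
have f2e : idot f2 e = 0 by apply: idot_box_box => -[]; lia.
have pe : primitive_vec e by apply: (@primitive_idot _ e); exact: idot_box_self.
(* In the first row or column [lower_min] is 0 and at most one of [f1], [f2] is nonzero, so adding
   [lower_max] is a single shear. *)
have [/andP[a1 b1]|nab] := boolP ((1 < a)%N && (1 < b)%N); last first.
  suff -> : theta_set t.+1 = shear (f1 + f2) e (theta_set t).
    apply: mutation_chain1; apply: seg_mutation_shear => //; first exact: cvx_theta_set.
    by rewrite idotDl f1e f2e.
  rewrite /theta_set /shear; apply/funext => y /=; congr (state _ _ _ _ _).
  apply: theta_succ => // u v; rewrite ext_add ext_box// -/a -/b.
  rewrite int_vecD dotDr !dot_box /lower_max /lower_min (negPf nab) subr0 if_same addr0.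
  by case: (_ && _); rewrite ?mulr1 ?mulr0.
have Lab1 : cell a.-1 b.-1.
  by apply: ML; apply: (yM.2 _ _ _ _ Mij); clear -a1 b1; lia.
(* The toggle adds the minimum of the lower neighbours at the preceding diagonal box and subtracts
   it at [(a, b)]; the shear then adds their sum at [(a, b)], which completes the maximum. *)
pose w := box_vec a.-1 b.-1 - e.
have f1w : idot f1 w = 0.
  by rewrite idotDr idotNr f1e oppr0 addr0; apply: idot_box_box => -[]; lia.
have f2w : idot f2 w = 0.
  by rewrite idotDr idotNr f2e oppr0 addr0; apply: idot_box_box => -[]; lia.
have pw : primitive_vec w.
  apply: (@primitive_idot _ (box_vec a.-1 b.-1)).
  by rewrite idotDr idotNr idot_box_self// idot_box_box ?subr0// => -[]; lia.
apply: (@mutation_chain_toggle_shear _ _ w e f1 f2) => //; first exact: cvx_theta_set.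
rewrite /theta_set; apply/funext => y /=; congr (state _ _ _ _ _).
apply: theta_succ => // u v; rewrite -/a -/b ext_add ext_box//.
rewrite /toggle ext_add int_vecD int_vecN -scaleN1r ext_add !ext_box//.
rewrite !dot_box /lower_max /lower_min a1 b1 /=.
have [e1|ne1] := boolP ((u == a) && (v == b))%N.
  rewrite !ifF; [|by clear -e1; lia..].
  have -> : ((u == a.-1) && (v == b.-1))%N = false by clear -e1 a0; lia.
  by rewrite /=; ring.
have -> : [&& 0 < u, 0 < v, u.+1 == a & v.+1 == b]%N = ((u == a.-1) && (v == b.-1))%N.
  by clear -a1 b1; lia.
by case: ifP => _ /=; ring.
Qed.

Lemma mutation_chain_remove : mutation_chain (state_set M)
  [set y | state_set (remove i j M) (flip (fun p : lam => below i j (val p).1 (val p).2) y)].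
Proof.
have -> : state_set M = theta_set 0.
  by rewrite /state_set /theta_set; apply/funext => y /=; rewrite theta0.
have -> : [set y | state_set (remove i j M)
   (flip (fun p : lam => below i j (val p).1 (val p).2) y)] = theta_set i.
  apply/funext => y /=; rewrite /theta_set /state_set /=; apply/propext.
  have := state_remove yL yM ML Mij Mi Mj (@supported_ext y) k D.
  suff -> : ext (flip (fun p : lam => below i j (val p).1 (val p).2) y) =
    negate_below i j (ext y) by move=> [h1 h2]; split.
  apply/funext => u; apply/funext => v; rewrite /negate_below /ext.
  case: insubP => [p _ e|_]; last by rewrite oppr0 if_same.
  by rewrite ffunE e.
have H t : (t <= i)%N -> mutation_chain (theta_set 0) (theta_set t).
  elim: t => [_|t IH ti]; first exact: mutation_chain_refl.
  by apply: mutation_chain_trans (IH (ltnW ti)) _; exact: mutation_chain_theta_set.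
exact: H.
Qed.

End Step.

(** Induction on the number of boxes: a box of [M] with maximal coordinate sum is a corner. The sign
    changes accumulate in [e] by exclusive or. The condition on [e] will keep the boxes of the two
    extreme diagonals out of it. *)
Lemma mutation_chain_empty M k D : young cell -> young M -> (forall u v, M u v -> cell u v) ->
  exists e : pred lam, (forall p, e p -> M (val p).1.+1 (val p).2.+1) /\
    mutation_chain (state_set k D M) [set y | state_set k D (fun _ _ => false) (flip e y)].
Proof.
move=> yL; move En : #|[pred p : lam | M (val p).1 (val p).2]| => n.
elim: n M En => [|n IH] M En yM ML.
  exists pred0; split=> //.
  have -> : M = fun _ _ => false.
    apply/funext => u; apply/funext => v; apply/negbTE/negP => Muv.
    have := fintype.card0_eq En (FSetSub (ML _ _ Muv)).
    by rewrite inE /= Muv.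
  have -> : [set y : vec | state_set k D (fun _ _ => false) (flip pred0 y)] =
      state_set k D (fun _ _ => false).
    by apply/funext => y; rewrite /=; congr state_set; apply/ffunP => p; rewrite ffunE.
  exact: mutation_chain_refl.
have /card_gt0P[p0 Mp0] : (0 < #|[pred p : lam | M (val p).1 (val p).2]|)%N.
  by rewrite En.
pose m (p : lam) := ((val p).1 + (val p).2)%N.
have [p Mp pmax] := @arg_maxnP _ p0 (fun p => M (val p).1 (val p).2) m Mp0.
set i := (val p).1 in Mp; set j := (val p).2 in Mp.
have Mmax u v : M u v -> (u + v <= i + j)%N.
  by move=> Muv; have := pmax (FSetSub (ML _ _ Muv)) Muv.
have Mi : ~~ M i.+1 j by apply/negP => /Mmax; rewrite addSn ltnn.
have Mj : ~~ M i j.+1 by apply/negP => /Mmax; rewrite addnS ltnn.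
have yN := young_remove yM Mi Mj.
have NM u v : remove i j M u v -> M u v by case/andP.
have [||e [e1 e2]] := IH (remove i j M) _ yN.
- rewrite (cardD1 p) inE Mp add1n in En; case: En => <-.
  apply: eq_card => q; rewrite !inE /remove andbC; congr (~~ _ && _).
- by move=> u v /NM; exact: ML.
have := mutation_chain_remove k D yL yM ML Mp Mi Mj.
move=> h; pose e' := fun p : lam => below i j (val p).1 (val p).2.
exists (fun p => e p (+) e' p); split=> [q|].
  have := e1 q; case: (e q) => /= [/(_ isT)/NM//|_ /andP[d qi]].
  by have [] := on_diag_up yM Mp Mi Mj d qi.
apply: mutation_chain_trans h _; have := mutation_chain_flip e' e2; congr mutation_chain.
apply/funext => y; rewrite /=; congr state_set; apply/ffunP => q; rewrite !ffunE.
by case: (e q); case: (e' q); rewrite //= opprK.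
Qed.

End Diagram.

(** * The two restricted polytopes *)

Lemma increasing_le (R : realType) M (X : nat -> nat -> R) a b u v : young M ->
  increasing M X -> M u v -> (0 < a <= u)%N -> (0 < b <= v)%N -> X a b <= X u v.
Proof.
move=> [_ yM] iX + /andP[a0 au] /andP[b0 bv].
have H1 n : M (a + n)%N v -> X a v <= X (a + n)%N v.
  elim: n => [|n IH]; first by rewrite addn0.
  rewrite addnS => h; apply: le_trans (iX _ _ h).1; apply: IH.
  by apply: (yM _ _ _ _ h); rewrite ?addn_gt0 ?a0 ?leqnSn //= (leq_trans b0 bv) leqnn.
have H2 n : M a (b + n)%N -> X a b <= X a (b + n)%N.
  elim: n => [|n IH]; first by rewrite addn0.
  rewrite addnS => h; apply: le_trans (iX _ _ h).2; apply: IH.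
  by apply: (yM _ _ _ _ h); rewrite ?addn_gt0 ?b0 ?leqnSn // a0 leqnn.
move=> Muv; apply: (@le_trans _ _ (X a v)); last by have := H1 (u - a)%N; rewrite subnKC//; apply.
have := H2 (v - b)%N; rewrite subnKC//; apply.
by apply: (yM _ _ _ _ Muv); rewrite ?a0 // (leq_trans b0 bv) leqnn.
Qed.

Section Identification.
Variables (R : realType) (lam : {fset grid}) (m1 m2 k : nat) (d : int -> nat).
Hypotheses (hlam : young_diagram lam) (hm : smallest_box lam m1 m2) (hk : (0 < k)%N).
Local Notation vec := {ffun lam -> R^o}.
Local Notation cell := (cell lam).
Implicit Types (x : vec) (p q r : lam).

Definition diag_value (u v : nat) : R := (d (u%:Z - v%:Z))%:R.

Definition in_range (l : int) := 1 - m2%:Z <= l <= m1%:Z - 1.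

Lemma young_cell : young cell.
Proof.
have [_ h1 h2] := hlam; split=> [u v /h1[/= -> ->]//|u v a b h /andP[a0 au] /andP[b0 bv]].
by apply: (h2 (u, v)) => //; rewrite leEprod !leEnat /= au bv.
Qed.

Lemma le_val p q : (val p <= val q)%O = ((val p).1 <= (val q).1)%N && ((val p).2 <= (val q).2)%N.
Proof. by rewrite leEprod !leEnat. Qed.

Lemma cell_box u v : cell u v -> (0 < u <= m1)%N /\ (0 < v <= m2)%N.
Proof. by have [_ _ h _] := hm; move=> /h. Qed.

(** Otherwise the bounding box could be narrowed, against its minimality. *)
Lemma cell_m1 : cell m1 1.
Proof.
have [m10 m20 hb hmin] := hm.
apply: contraT => ncell; have : in_box lam m1.-1 m2.
  move=> [u v] uv; have [/andP[u0 um] v0] := cell_box uv; split=> //=.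
  rewrite u0 /= -ltnS prednK// ltn_neqAle um andbT.
  apply: contra ncell => /eqP e; apply: (young_cell.2 _ _ _ _ uv); rewrite ?e ?m10 ?leqnn//.
  by case/andP: v0.
by move=> /hmin[]; rewrite leqNgt ltn_predL m10.
Qed.

Lemma cell_m2 : cell 1 m2.
Proof.
have [m10 m20 hb hmin] := hm.
apply: contraT => ncell; have : in_box lam m1 m2.-1.
  move=> [u v] uv; have [u0 /andP[v0 vm]] := cell_box uv; split=> //=.
  rewrite v0 /= -ltnS prednK// ltn_neqAle vm andbT.
  apply: contra ncell => /eqP e; apply: (young_cell.2 _ _ _ _ uv); rewrite ?e ?m20 ?leqnn//.
  by case/andP: u0.
by move=> /hmin[] _; rewrite leqNgt ltn_predL m20.
Qed.

(** Each diagonal in the range starts in the first row or column, below [cell_m2] or [cell_m1]; its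
    last box is found by maximality. *)
Lemma range_rim l : in_range l -> exists u v,
  [/\ cell u v, ~~ cell u.+1 v.+1 & u%:Z - v%:Z = l].
Proof.
move=> /andP[l1 l2].
have [a [b [ab eab]]] : exists a b, cell a b /\ a%:Z - b%:Z = l.
  have [l0|l0] := lerP 0 l.
    exists `|l|.+1%N, 1%N; split; last by lia.
    by apply: (young_cell.2 _ _ _ _ cell_m1) => //; lia.
  exists 1%N, `|l|.+1%N; split; last by lia.
  by apply: (young_cell.2 _ _ _ _ cell_m2) => //; lia.
have ex : exists t, cell (a + t)%N (b + t)%N by exists 0%N; rewrite !addn0.
have bd t : cell (a + t)%N (b + t)%N -> (t <= m1)%N.
  by move=> /cell_box[/andP[_ h] _]; apply: leq_trans h; exact: leq_addl.
have [t ct tmax] := ex_maxnP ex bd.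
exists (a + t)%N, (b + t)%N; split=> //; last by rewrite -eab; lia.
by apply/negP => h; have := tmax t.+1; rewrite !addnS ltnn => /(_ h).
Qed.

Lemma in_range_diag p : in_range (diag (val p)).
Proof.
have [/andP[h1 h2] /andP[h3 h4]] := cell_box (cell_val p).
by move: h1 h2 h3 h4; rewrite /in_range /diag; move: (val p) => [u v] /=; lia.
Qed.

Lemma diag_sum_ext x u v : diag_sum (ext x) u v =
  \sum_(p : lam | (diag (val p) == u%:Z - v%:Z) && ((val p).1 <= u)%N) x p.
Proof.
have gt0 p : (0 < (val p).1)%N && (0 < (val p).2)%N := young_cell.1 _ _ (cell_val p).
elim: u v => [|u IH] v.
  rewrite diag_sum0l big_pred0// => p.
  by have /andP[h _] := gt0 p; rewrite leqNgt h andbF.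
case: v => [|v].
  rewrite (diag_sum0r _ young_cell) ?big_pred0//; last exact: supported_ext.
  by move=> p; have := gt0 p; rewrite /diag; case: (val p) => a b /=; lia.
rewrite diag_sum_rec IH [LHS]addrC [RHS](bigID (fun p => (val p).1 <= u)%N); congr (_ + _).
  by apply: eq_bigl => p; rewrite /diag; case: (val p) => a b /=; lia.
have [h|h] := boolP (cell u.+1 v.+1).
  rewrite (ext_cell _ h) (big_pred1 (FSetSub h))// => p.
  rewrite [RHS](_ : _ = ((val p).1 == u.+1) && ((val p).2 == v.+1))//.
  by rewrite /diag; case: (val p) => a b /=; lia.
rewrite supported_ext// big_pred0// => p; apply/negP => hp.
have := cell_val p; have [-> ->] : (val p).1 = u.+1 /\ (val p).2 = v.+1.
  by move: hp; rewrite /diag; case: (val p) => a b /=; lia.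
exact/negP.
Qed.

Lemma diag_sum_rim x u v : ~~ cell u.+1 v.+1 ->
  diag_sum (ext x) u v = \sum_(p : lam | diag (val p) == u%:Z - v%:Z) x p.
Proof.
move=> h; rewrite diag_sum_ext; apply: eq_bigl => p.
case: eqP => //= e; rewrite leqNgt; apply: contra h => pu.
by apply: (young_cell.2 _ _ _ _ (cell_val p)); move: e pu; rewrite /diag /=; case: (fsval p) => a b /=; lia.
Qed.

Lemma dilate_order x : dilate k (@order_polytope R lam) x <->
  forall p q, (val p <= val q)%O -> [/\ 0 <= x p, x p <= x q & x q <= k%:R].
Proof.
have k0 : 0 < k%:R :> R by rewrite ltr0n.
split=> [[z Oz <-] p q pq|H].
  have [h1 h2 h3] := Oz p q pq; rewrite !ffunE /GRing.scale /=.
  by rewrite mulr_ge0 ?ler_wpM2l ?ler_piMr ?(ltW k0).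
exists (k%:R^-1 *: x); last by rewrite scalerA mulfV ?scale1r// gt_eqF.
move=> p q /H[h1 h2 h3]; rewrite !ffunE /GRing.scale /=.
by rewrite mulr_ge0 ?ler_wpM2l ?invr_ge0 ?(ltW k0)// mulrC ler_pdivrMr// mul1r.
Qed.

Lemma dilate_chain x : dilate k (@chain_polytope R lam) x <->
  forall s : seq lam, sorted (fun p q => (val p < val q)%O) s ->
    0 <= \sum_(p <- s) x p <= k%:R.
Proof.
have k0 : 0 < k%:R :> R by rewrite ltr0n.
split=> [[z Cz <-] s /Cz/andP[h1 h2]|H].
  under eq_bigr do rewrite ffunE /GRing.scale /=.
  by rewrite -mulr_sumr mulr_ge0 ?(ltW k0)// ler_piMr ?(ltW k0).
exists (k%:R^-1 *: x); last by rewrite scalerA mulfV ?scale1r// gt_eqF.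
move=> s /H/andP[h1 h2]; under eq_bigr do rewrite ffunE /GRing.scale /=.
by rewrite -mulr_sumr mulr_ge0 ?invr_ge0 ?(ltW k0)// mulrC ler_pdivrMr// mul1r.
Qed.

(** Before any removal the filling is its own potential, and [rect_sums] constrains the filling only
    through the sums at the last boxes of the diagonals; [E] can be 0 elsewhere. *)
Lemma restricted_orderE :
  restricted_order_polytope R lam m1 m2 k d = state_set k%:R diag_value cell.
Proof.
have yL := young_cell; apply/funext => x; apply/propext; split.
  move=> [/dilate_order H Hd]; split.
  - move=> u v h; have /andP[u0 v0] := yL.1 _ _ h; split.
      have [h'|h'] := boolP (cell u.-1 v); last first.
        by rewrite supported_ext// (ext_cell _ h); have [] := H _ _ (lexx (val (FSetSub h))).
      rewrite (ext_cell _ h') (ext_cell _ h).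
      by have [] := H (FSetSub h') (FSetSub h); rewrite // le_val /= leq_pred leqnn.
    have [h'|h'] := boolP (cell u v.-1); last first.
      by rewrite supported_ext// (ext_cell _ h); have [] := H _ _ (lexx (val (FSetSub h))).
    rewrite (ext_cell _ h') (ext_cell _ h).
    by have [] := H (FSetSub h') (FSetSub h); rewrite // le_val /= leq_pred leqnn.
  - by move=> u v ->.
  - exists (ext x); split=> //; first exact: supported_ext.
      by move=> u v h; rewrite (ext_cell _ h); have [] := H _ _ (lexx (val (FSetSub h))).
    by move=> u v ->.
  - exists (fun u v => if cell u v && ~~ cell u.+1 v.+1 then diag_value u v else 0); split.
    + move=> u v uv; rewrite ifF//; apply: contraTF uv => /andP[/(yL.1)/andP[u0 v0] _].
      by rewrite negb_or -!lt0n u0.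
    + move=> u v h h1; rewrite h h1 /= diag_sum_rim// Hd//.
      by have := in_range_diag (FSetSub h).
    + by move=> u v ->.
    + by move=> u v -> ->.
move=> [iX _ [G [G1 _ G3 _]] [E [_ E2 _ E4]]]; split.
  apply/dilate_order => p q; rewrite le_val => /andP[h1 h2].
  have cp := cell_val p; have cq := cell_val q; have /andP[p1 p2] := yL.1 _ _ cp.
  split.
  - by rewrite -ext_val; apply: (increasing_ge0 yL _ yL iX) => //; exact: supported_ext.
  - by rewrite -[x p]ext_val -[x q]ext_val; apply: (increasing_le yL iX) => //; apply/andP.
  - by rewrite -ext_val -G1// G3.
move=> l lr; have [u [v [uv uv1 <-]]] := range_rim lr.
by rewrite -diag_sum_rim// -E2// E4.
Qed.

(** * The chain polytope: rectangle sums and last-passage values *)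

Definition rect_sum x u v : R :=
  \sum_(p : lam | ((val p).1 <= u)%N && ((val p).2 <= v)%N) x p.

Lemma rect_sum_rec x u v : (0 < u)%N -> (0 < v)%N ->
  ext x u v = rect_sum x u v + rect_sum x u.-1 v.-1 - rect_sum x u.-1 v - rect_sum x u v.-1.
Proof.
move=> u0 v0.
have -> : ext x u v = \sum_p (if ((val p).1 == u) && ((val p).2 == v) then x p else 0).
  have [h|h] := boolP (cell u v).
    rewrite (ext_cell _ h) -big_mkcond (big_pred1 (FSetSub h))// => p.
  rewrite supported_ext// big1// => p _; case: andP => // -[/eqP e1 /eqP e2].
  by move: h; rewrite -e1 -e2 cell_val.
have rs a b : rect_sum x a b =
    \sum_p (if ((val p).1 <= a)%N && ((val p).2 <= b)%N then x p else 0).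
  by rewrite /rect_sum big_mkcond.
rewrite !rs -!sumrN -!big_split; apply: eq_bigr => p _ /=.
case: u v u0 v0 => // u [] // v _ _ /=; case: (fsval p) => a b /=.
have -> : (a <= u.+1)%N = (a == u.+1) || (a <= u)%N by rewrite leq_eqVlt ltnS.
have -> : (b <= v.+1)%N = (b == v.+1) || (b <= v)%N by rewrite leq_eqVlt ltnS.
case: (eqVneq a u.+1) => [->|_]; case: (eqVneq b v.+1) => [->|_] /=;
  rewrite ?ltnn ?andbF ?andbT //=; try (case: (a <= u)%N; case: (b <= v)%N);
  rewrite /= ?subrr ?oppr0 ?addr0 ?subr0 //; ring.
Qed.

Lemma rect_sum0 x u v : (u == 0)%N || (v == 0)%N -> rect_sum x u v = 0.
Proof.
move=> uv; rewrite /rect_sum big_pred0// => p.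
by have := young_cell.1 _ _ (cell_val p); case: (val p) => a b /=; lia.
Qed.

Lemma max_on_diagE l r : max_on_diag l r <->
  diag (val r) = l /\ ~~ cell (val r).1.+1 (val r).2.+1.
Proof.
rewrite /max_on_diag; split=> -[<- H]; split=> //.
  apply/negP => h; have := H (FSetSub h); rewrite le_val /diag /= !leqnSn => /(_ _ isT) e.
  have /(congr1 (fun p : lam => (val p).1)) /= : FSetSub h = r by apply: e; lia.
  by lia.
move=> p; rewrite /diag le_val => e /andP[h1 h2].
have e1 : (val p).1 = (val r).1.
  apply/eqP; rewrite eqn_leq h1 andbT leqNgt; apply: contra H => h.
  apply: (young_cell.2 _ _ _ _ (cell_val p)); move: e h;
    by case: (val p) (val r) => a b [a' b'] /=; lia.
have e2 : (val p).2 = (val r).2.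
  by move: e e1; case: (val p) (val r) => a b [a' b'] /=; lia.
by apply: val_inj; rewrite [LHS]surjective_pairing [RHS]surjective_pairing e1 e2.
Qed.

(** For nonnegative weights, the largest weight of a lattice path ending at [(u, v)], with fuel [n].
    A step back lowers [u + v] by 1, so [u + v] is enough fuel. *)
Fixpoint last_passage (X : nat -> nat -> R) n u v : R :=
  if n is n'.+1 then
    if cell u v then
      X u v + Num.max (last_passage X n' u.-1 v) (last_passage X n' u v.-1)
    else 0
  else 0.

Lemma last_passageS X n u v : cell u v -> last_passage X n.+1 u v =
  X u v + Num.max (last_passage X n u.-1 v) (last_passage X n u v.-1).
Proof. by rewrite /= => ->. Qed.

(** Attainment by a chain transfers the bound [k] from chains to the last-passage value, which can
    then serve as a potential. *)
Lemma last_passage_chain x n u v : exists s : seq lam,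
  [/\ sorted (fun p q => (val p < val q)%O) s,
      all (fun p => ((val p).1 <= u)%N && ((val p).2 <= v)%N) s &
      \sum_(p <- s) x p = last_passage (ext x) n u v].
Proof.
elim: n u v => [|n IH] u v /=; first by exists [::]; rewrite big_nil.
have [h|h] := boolP (cell u v); last by exists [::]; rewrite big_nil.
have /andP[u0 v0] := young_cell.1 _ _ h.
have tr : transitive (fun p q : lam => (val p < val q)%O) by move=> a b c; exact: lt_trans.
have ext_chain a b : (a <= u)%N -> (b <= v)%N -> (a < u)%N || (b < v)%N ->
    (exists s : seq lam, [/\ sorted (fun p q => (val p < val q)%O) s,
      all (fun p => ((val p).1 <= a)%N && ((val p).2 <= b)%N) s &
      \sum_(p <- s) x p = last_passage (ext x) n a b]) ->
    exists s : seq lam, [/\ sorted (fun p q => (val p < val q)%O) s,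
      all (fun p => ((val p).1 <= u)%N && ((val p).2 <= v)%N) s &
      \sum_(p <- s) x p = ext x u v + last_passage (ext x) n a b].
  move=> au bv ab [s [s1 s2 s3]]; exists (rcons s (FSetSub h)); split.
  - rewrite (sorted_pairwise tr) pairwise_rcons -(sorted_pairwise tr) s1 andbT.
    apply: sub_all s2 => p /andP[p1 p2].
    rewrite lt_neqAle; apply/andP; split; last first.
      by rewrite le_val /= (leq_trans p1 au) (leq_trans p2 bv).
    by apply/eqP => e; move: p1 p2 ab; rewrite e /= => p1 p2; lia.
  - rewrite all_rcons /= !leqnn /=; apply: sub_all s2 => p /andP[p1 p2].
    by rewrite (leq_trans p1 au) (leq_trans p2 bv).
  - by rewrite -cats1 big_cat big_seq1 /= s3 (ext_cell _ h) addrC.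
rewrite maxElt; case: ifP => _.
  by apply: ext_chain (IH u v.-1); rewrite ?leq_pred// ltn_predL v0 orbT.
by apply: ext_chain (IH u.-1 v); rewrite ?leq_pred// ltn_predL u0.
Qed.

(** After all removals a potential bounded by [k] exists exactly when no chain weighs more than [k]:
    last passage provides one, and conversely any potential grows along a chain by at least the
    weights. Inclusion-exclusion determines [E] as the rectangle sums. *)
Lemma restricted_chainE :
  restricted_chain_polytope R lam m1 m2 k d =
  state_set k%:R diag_value (fun _ _ => false).
Proof.
have yL := young_cell; apply/funext => x; apply/propext; split.
  move=> [/dilate_chain H Hd].
  have X0 u v : cell u v -> 0 <= ext x u v.
    move=> h; have := H [:: FSetSub h] isT.
    by rewrite big_seq1 (ext_cell _ h) => /andP[].
  split=> //; first by move=> u v h _; exact: X0.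
  - exists (fun u v => last_passage (ext x) (u + v) u v); split=> //.
    + by move=> u v; case: (u + v)%N => //= n /negPf ->.
    + move=> u v _; have [s [s1 _ <-]] := last_passage_chain x (u + v) u v.
      by case/andP: (H s s1).
    + move=> u v h _; have /andP[u0 v0] := yL.1 _ _ h.
      case: u v u0 v0 h => // u [] // v _ _ h.
      have e1 : (u.+1 + v.+1 = (u + v.+1).+1)%N by [].
      have e2 : (u.+1 + v = u + v.+1)%N by rewrite addSnnS.
      by rewrite !succnK e1 e2 last_passageS// !lerD2l !le_max !lexx orbT.
  - exists (rect_sum x); split=> //.
    + exact: rect_sum0.
    + by move=> u v h _; have /andP[u0 v0] := yL.1 _ _ h; exact: rect_sum_rec.
    + move=> u v h h1; rewrite /rect_sum /diag_value.
      have := Hd (diag (val (FSetSub h))) (in_range_diag _) (FSetSub h).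
      move=> <-; last by apply/max_on_diagE.
      by apply: eq_bigl => p; rewrite le_val.
move=> [_ X0 [G [_ G2 G3 G4]] [E [E1 _ E3 E4]]]; split.
  have iG : increasing cell G.
    by move=> u v h; have := G4 _ _ h isT; have := X0 _ _ h isT; split; lra.
  have G0 u v : 0 <= G u v.
    have [h|h] := boolP (cell u v); last by rewrite G2.
    exact: (increasing_ge0 yL _ yL iG).
  have Gx p : x p <= G (val p).1 (val p).2.
    have [h _] := G4 _ _ (cell_val p) isT; apply: le_trans h.
    by rewrite ext_val lerDl.
  (* One of the lower neighbours of [q] is still at or above [p], so monotonicity and one step of
     the potential suffice. *)
  have Glt p q : (val p < val q)%O -> x q + G (val p).1 (val p).2 <= G (val q).1 (val q).2.
    rewrite lt_neqAle le_val => /andP[ne /andP[h1 h2]].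
    have /andP[p1 p2] := yL.1 _ _ (cell_val p).
    have [g1 g2] := G4 _ _ (cell_val q) isT; rewrite ext_val in g1 g2.
    have [h|h] := ltnP (val p).1 (val q).1.
      apply: le_trans g1; rewrite lerD2l; apply: (increasing_le yL iG); [|lia|lia].
      by apply: (yL.2 _ _ _ _ (cell_val q)); lia.
    have h' : ((val p).2 < (val q).2)%N.
      rewrite ltn_neqAle h2 andbT; apply: contra ne => /eqP e.
      have e1 : (val p).1 = (val q).1 by lia.
      by apply/eqP; rewrite [LHS]surjective_pairing [RHS]surjective_pairing e1 e.
    apply: le_trans g2; rewrite lerD2l; apply: (increasing_le yL iG); [|lia|lia].
    by apply: (yL.2 _ _ _ _ (cell_val q)); lia.
  have Gpath s : forall p, path (fun p q => (val p < val q)%O) p s ->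
      \sum_(q <- s) x q + G (val p).1 (val p).2 <= G (val (last p s)).1 (val (last p s)).2.
    elim: s => [|q s IH] p /=; first by rewrite big_nil add0r.
    move=> /andP[pq /IH h]; apply: le_trans h; rewrite big_cons addrAC addrC lerD2l.
    exact: Glt.
  apply/dilate_chain => s hs; apply/andP; split.
    apply: sumr_ge0 => p _; rewrite -ext_val; apply: X0 => //; exact: cell_val.
  case: s hs => [|p s] hs; first by rewrite big_nil.
  apply: (@le_trans _ _ (G (val (last p s)).1 (val (last p s)).2)).
    apply: le_trans (Gpath _ _ hs); rewrite big_cons addrC lerD2l; exact: Gx.
  by apply: G3; exact: cell_val.
have EE n : forall u v, (u + v <= n)%N -> ((u == 0) || (v == 0))%N || cell u v ->
    E u v = rect_sum x u v.
  elim: n => [|n IH] u v uvn /orP[uv|h]; try by rewrite E1// rect_sum0.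
    by have /andP[] := yL.1 _ _ h; lia.
  have /andP[u0 v0] := yL.1 _ _ h.
  have sub a b : (a <= u)%N -> (b <= v)%N -> ((a == 0) || (b == 0))%N || cell a b.
    move=> au bv; have [//|ab] := boolP ((a == 0) || (b == 0))%N.
    by apply: (yL.2 _ _ _ _ h); lia.
  have := E3 _ _ h isT; rewrite rect_sum_rec//.
  rewrite (IH u.-1 v.-1) ?(IH u.-1 v) ?(IH u v.-1) ?sub ?leq_pred//; try by lia.
  by lra.
move=> l lr r /max_on_diagE[<- rim].
have cr := cell_val r.
transitivity (rect_sum x (val r).1 (val r).2).
  by apply: eq_bigl => p; rewrite le_val.
by rewrite -(EE _ _ _ (leqnn _)) ?cr ?orbT// E4.
Qed.

Lemma polytope_restricted_order : polytope (restricted_order_polytope R lam m1 m2 k d).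
Proof.
(* The entries are at most [k], so this bounds their sum. *)
pose B : R := k%:R * #|{: lam}|%:R.
have [p0 _] : exists p : lam, true by exists (FSetSub cell_m1).
have B0 : 0 < B.
  by rewrite mulr_gt0 ?ltr0n//; apply/card_gt0P; exists p0.
pose e p : vec := int_vec R (unit_vec p).
pose ind (l : int) : vec := [ffun p => (diag (val p) == l)%:R].
have dot_ind x l : dot x (ind l) = \sum_(p : lam | diag (val p) == l) x p.
  rewrite [RHS]big_mkcond; apply: eq_bigr => p _; rewrite ffunE.
  by case: (_ == _); rewrite ?mulr1 ?mulr0.
(* The half-spaces are the order relations, the bounds by [k], and two opposite inequalities for
   each diagonal sum. *)
pose s : seq (vec * R) :=
  [seq (e pq.1 - e pq.2, 0) | pq <- enum [pred pq : lam * lam | (val pq.1 <= val pq.2)%O]]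
  ++ [seq (e p, k%:R) | p <- enum {: lam}]
  ++ [seq (ind (diag (val p)), (d (diag (val p)))%:R) | p <- enum {: lam}]
  ++ [seq (- ind (diag (val p)), - (d (diag (val p)))%:R) | p <- enum {: lam}].
have := polytope_cuts s (polytope_simplex lam B0); congr polytope.
have dotN x v : dot x (- v) = - dot x v :> R by rewrite -scaleN1r dotZr mulN1r.
apply/seteqP; split=> x.
  move=> [[x0 xB] H]; split.
    apply/dilate_order => p q pq; split=> //.
      have /H : (e p - e q, 0) \in s.
        by rewrite !mem_cat; apply/or4P/Or41/mapP; exists (p, q); rewrite ?mem_enum.
      by rewrite /= dotDr dotN !dot_unit subr_le0.
    have /H : (e q, k%:R) \in s.
      by rewrite !mem_cat; apply/or4P/Or42/mapP; exists q; rewrite ?mem_enum.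
    by rewrite /= dot_unit.
  move=> l lr; have [u [v [uv uv1 <-]]] := range_rim lr.
  set p := FSetSub uv.
  have /H h1 : (ind (diag (val p)), (d (diag (val p)))%:R) \in s.
    by rewrite !mem_cat; apply/or4P/Or43/mapP; exists p; rewrite ?mem_enum.
  have /H h2 : (- ind (diag (val p)), - (d (diag (val p)))%:R) \in s.
    by rewrite !mem_cat; apply/or4P/Or44/mapP; exists p; rewrite ?mem_enum.
  move: h1 h2; rewrite /= dotN dot_ind lerN2 => h1 h2.
  by apply: le_anti; rewrite h1 h2.
move=> [/dilate_order Hx Hd].
have x0 p : 0 <= x p by have [] := Hx p p (lexx _).
have xk p : x p <= k%:R by have [] := Hx p p (lexx _).
split.
  split=> //; rewrite /B mulr_natr -sumr_const; exact: ler_sum.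
move=> h; rewrite !mem_cat => /or4P[] /mapP[p hp ->] /=.
- by move: hp; rewrite mem_enum inE dotDr dotN !dot_unit subr_le0 => /Hx[].
- by rewrite dot_unit.
- by rewrite dot_ind Hd//; exact: in_range_diag.
- by rewrite dotN dot_ind Hd//; exact: in_range_diag.
Qed.

(** The two extreme diagonals consist of a single box each, so their prescribed sums fix these
    entries. *)
Lemma restricted_order_corners x :
  restricted_order_polytope R lam m1 m2 k d x ->
  x (FSetSub cell_m1) = (d (m1%:Z - 1))%:R /\ x (FSetSub cell_m2) = (d (1 - m2%:Z))%:R.
Proof.
have yL := young_cell; have sx := supported_ext x.
rewrite restricted_orderE => -[_ _ _ [E [_ E2 _ E4]]].
have n1 : ~~ cell m1.+1 2 by apply/negP => /cell_box[/andP[_]]; rewrite ltnn.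
have n2 : ~~ cell 2 m2.+1 by apply/negP => /cell_box[_ /andP[_]]; rewrite ltnn.
have [m10 m20 _ _] := hm; split.
  rewrite -(ext_cell x cell_m1).
  have := E2 _ _ cell_m1 n1; rewrite E4 ?cell_m1// (diag_sumE _ _ yL sx) /=.
  by rewrite (diag_sum0r _ yL sx) addr0 => <-.
rewrite -(ext_cell x cell_m2).
have := E2 _ _ cell_m2 n2; rewrite E4 ?cell_m2// (diag_sumE _ _ yL sx) /=.
by rewrite diag_sum0l addr0 => <-.
Qed.

End Identification.

Theorem theorem3p1 (R : realType) (lam : {fset grid}) (m1 m2 : nat)
    (d : int -> nat) (k : nat)
    (hlam : young_diagram lam)
    (hm : smallest_box lam m1 m2)
    (hd : forall l : int, 1 - m2%:Z <= l <= m1%:Z - 1 -> (0 < d l)%N)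
    (hk : (0 < k)%N) :
  mutation_equivalent
    (restricted_order_polytope R lam m1 m2 k d)
    (restricted_chain_polytope R lam m1 m2 k d).
Proof.
have pO := polytope_restricted_order R d hlam hm hk.
apply: mutation_chain_equivalent => //.
have yL := young_cell hlam.
have [e [e1]] := mutation_chain_empty k%:R (diag_value R d) yL yL (fun u v => id).
rewrite -(restricted_orderE R d hlam hm hk) -(restricted_chainE R d hlam hm hk) => e2.
have eC : [set y | [set y | restricted_chain_polytope R lam m1 m2 k d (flip e y)] (flip e y)]
    = restricted_chain_polytope R lam m1 m2 k d.
  by apply/funext => y /=; rewrite flipK.
(* Conjugation by [e] moves the sign change from the chain polytope to the order polytope, where two
   coordinates are constant. *)
rewrite -eC; apply: mutation_chain_trans (mutation_chain_flip e e2).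
(* A flipped box lies strictly below another box, so [m1 > 1] and the two extreme boxes differ.
   Without flipped boxes they may coincide, but then no sign has to be changed. *)
have [/existsP[p ep]|ne] := boolP [exists p, e p]; last first.
  have -> : [set y | restricted_order_polytope R lam m1 m2 k d (flip e y)] =
      restricted_order_polytope R lam m1 m2 k d.
    apply/funext => y /=; congr (restricted_order_polytope R lam m1 m2 k d _).
    apply/ffunP => q; rewrite ffunE ifF//; apply/negbTE.
    by apply: contra ne => eq; apply/existsP; exists q.
  exact: mutation_chain_refl.
have [/andP[_ pm1] _] := cell_box hm (e1 _ ep).
have [m10 m20 _ _] := hm.
have p0 : (0 < (val p).1)%N by have /andP[] := yL.1 _ _ (cell_val p).
apply: (@mutation_chain_flips _ _ _ (FSetSub (cell_m1 hlam hm)) (FSetSub (cell_m2 hlam hm))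
  (d (m1%:Z - 1)) (d (1 - m2%:Z))).
- exact: polytope_cvx.
- by rewrite -val_eqE /= xpair_eqE; case: eqP => // h; have := leq_ltn_trans p0 pm1; rewrite h.
- by apply/negP => /e1 /(cell_box hm) /= [+ _]; rewrite ltnn.
- by apply/negP => /e1 /(cell_box hm) /= [_]; rewrite ltnn.
- by apply: hd; lia.
- by move=> x; exact: restricted_order_corners.
Qed.
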